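(* Let $f$ be a probability density on $\mathbb{R}$ with unit second moment which is $g$-concentrated (with error functions $\lambda_n$), with $\|f\|_\infty<\infty$, and assume $\sup_n\sup_u|\lambda_n(u)|<(2\pi)^{-1/2}$. Suppose $f(v)\ge e^{-\Phi(v)}$ for a positive function $\Phi$, and that for some $\beta>0$ $$M_{\Phi,\beta}=\int_{\mathbb{R}}\Phi(v)^{1+\beta}f(v)dv<\infty,\qquad M_{avg,\Phi,\beta}=\int_{\mathbb{R}^2}\left(\int_0^{2\pi}\Phi(v_1\cos\theta+v_2\sin\theta)^{1+\beta}d\theta\right)f(v_1)f(v_2)dv_1dv_2<\infty.$$ Then the conditioned tensorisations $F_N$ of $f$, $N\ge3$, have the log-power property of order $\beta$, with constant (for any $\epsilon>0$) $$C=\left[2^{1+2\beta}\sqrt3\,\frac{\|g\|_\infty+\sup|\lambda_{N-1}|}{(2\pi)^{-1/2}-\sup|\lambda_N|}\left(2\left(C_\epsilon\|f\|_\infty^\epsilon\right)^{1+\beta}+M_{\Phi,\beta}+M_{avg,\Phi,\beta}\right)\right]^{\frac1{1+\beta}},$$ where $C_\epsilon=\sup_{x\ge1}\frac{\log x}{x^\epsilon}$ and the suprema of $|\lambda_n|$ are taken over all $n$ and all arguments.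
   Context: $\mathbb{S}^{N-1}(r)$ is the sphere of radius $r$ in $\mathbb{R}^N$ with uniform probability measure $d\sigma^N_r$ ($d\sigma^N=d\sigma^N_{\sqrt N}$); $|\mathbb{S}^{n-1}|$ is the surface area of the unit sphere in $\mathbb{R}^n$. For a probability density $f$ on $\mathbb{R}$ with unit second moment, $\mathcal{Z}_N(f,r)=\int_{\mathbb{S}^{N-1}(r)}f^{\otimes N}d\sigma^N_r$ and the conditioned tensorisation is $F_N=f^{\otimes N}/\mathcal{Z}_N(f,\sqrt N)$. $f$ is $g$-concentrated if $\mathcal{Z}_N$ is well defined and for each fixed $k$, $\mathcal{Z}_{N-k}(f,\sqrt u)=\frac{2}{(N-k)^{1/2}|\mathbb{S}^{N-k-1}|u^{(N-k-2)/2}}\left(g(u-(N-k),N-k)+\lambda_{N-k}(u)\right)$, where $g$ is non-negative and bounded, $g(0,N)=(2\pi)^{-1/2}$ for all $N$, $\lim_{N\to\infty}\sup_u|\lambda_N(u)|=0$, and for every $R>0$, $\lim_{N\to\infty}\sup_{|x|<R}|g(x,N)-(2\pi)^{-1/2}|=0$. $R_{1,2,\theta}$ is the rotation $v_1\mapsto v_1\cos\theta+v_2\sin\theta$, $v_2\mapsto-v_1\sin\theta+v_2\cos\theta$, other coordinates fixed. A family $\{F_N\}$ has the log-power property of order $\beta>0$ with constant $C>0$ (independent of $N$) if $\frac1{2\pi}\int_0^{2\pi}\int_{\mathbb{S}^{N-1}(\sqrt N)}\psi_\beta(F_N,F_N\circ R_{1,2,\theta})d\sigma^Nd\theta\le C^{1+\beta}$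 for all $N$, where $\psi_\beta(x,y)=|x-y|\,|\log(x/y)|^{1+\beta}$. *)

(* Defs.v *)
From HB Require Import structures.
From mathcomp Require Import all_boot all_order all_algebra.
From mathcomp Require Import all_classical all_reals all_analysis.
Set Implicit Arguments. Unset Strict Implicit. Unset Printing Implicit Defensive.
Import Order.TTheory GRing.Theory Num.Theory.
Import numFieldNormedType.Exports.
Local Open Scope classical_set_scope.
Local Open Scope ring_scope.

Section Defs.
Variable R : realType.
Notation leb := (@lebesgue_measure R).

(* Points of R^N are represented by sequences v : nat -> R, of which only the
   first N coordinates v 0, ..., v (N-1) are used.  Coordinate "v_1" of the
   paper is v 0 and "v_2" is v 1. *)

Definition scons (x : R) (v : nat -> R) : nat -> R :=
  fun i => if i is j.+1 then v j else x.

(* Iterated Lebesgue integral over R^n of a function of the first n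
   coordinates (for non-negative measurable integrands this is the integral
   against n-dimensional Lebesgue measure, by Tonelli). *)
Fixpoint iint (n : nat) (F : (nat -> R) -> \bar R) : \bar R :=
  match n with
  | 0 => F (fun _ => 0)
  | n'.+1 => (\int[leb]_x iint n' (fun v => F (scons x v)))%E
  end.

Definition enorm (n : nat) (v : nat -> R) : R :=
  Num.sqrt (\sum_(i < n) v i ^+ 2).

Definition ball_vol (n : nat) : R :=
  fine (iint n (fun x => (if enorm n x < 1 then 1 else 0)%:E)).

(* |S^{n-1}| : surface area of the unit sphere in R^n  (= n |B^n|) *)
Definition sphere_area (n : nat) : R := n%:R * ball_vol n.

(* Integral of h against the uniform probability measure d sigma^N_r on the
   sphere S^{N-1}(r) of radius r in R^N, defined as the normalized cone
   measure: the push-forward of the normalized Lebesgue measure on the unit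
   ball under x |-> r x / |x|. *)
Definition sphere_int (N : nat) (r : R) (h : (nat -> R) -> \bar R) : \bar R :=
  ((ball_vol N)^-1%:E *
   iint N (fun x => if (enorm N x < 1)%R
                    then h (fun i => (r * x i / enorm N x)%R) else 0%E))%E.

Definition tens (f : R -> R) (N : nat) (v : nat -> R) : R :=
  \prod_(i < N) f (v i).

Definition ZN (f : R -> R) (N : nat) (r : R) : \bar R :=
  sphere_int N r (fun v => (tens f N v)%:E).

Definition condtens (f : R -> R) (N : nat) (v : nat -> R) : R :=
  tens f N v / fine (ZN f N (Num.sqrt N%:R)).

Definition rot12 (theta : R) (v : nat -> R) : nat -> R :=
  fun i => match i with
           | 0 => v 0%N * cos theta + v 1%N * sin theta
           | 1 => - v 0%N * sin theta + v 1%N * cos theta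
           | _ => v i
           end.

Definition psi (beta x y : R) : R :=
  `|x - y| * powR `|ln (x / y)| (1 + beta).

Definition log_power_functional (F : nat -> (nat -> R) -> R) (beta : R) (N : nat)
  : \bar R :=
  (((2 * pi)^-1)%R%:E *
   \int[leb]_(theta in `[0%R, (2 * pi)%R]%classic)
      sphere_int N (Num.sqrt N%:R)
        (fun v => (psi beta (F N v) (F N (rot12 theta v)))%:E))%E.

Definition log_power_property (F : nat -> (nat -> R) -> R) (beta C : R) : Prop :=
  0 < beta /\ 0 < C /\
  forall N : nat, (3 <= N)%N ->
    (log_power_functional F beta N <= (powR C (1 + beta))%:E)%E.

Definition g_concentrated (f : R -> R) (g : R -> nat -> R) (lam : nat -> R -> R)
  : Prop :=
  (* Z_n well defined and the defining identity (k fixed, n = N - k) *)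
      (forall (n : nat) (u : R), (1 <= n)%N -> 0 < u ->
         ZN f n (Num.sqrt u) =
         (2 / (Num.sqrt n%:R * sphere_area n * powR u ((n%:R - 2) / 2))
            * (g (u - n%:R) n + lam n u))%:E) /\
      (forall x n, 0 <= g x n) /\
      (exists M, forall x n, g x n <= M) /\
      (forall n, g 0 n = (Num.sqrt (2 * pi))^-1) /\
      (forall eps : R, 0 < eps -> exists N0 : nat, forall n u,
         (N0 <= n)%N -> 0 < u -> `|lam n u| <= eps) /\
      (forall R0 eps : R, 0 < R0 -> 0 < eps -> exists N0 : nat, forall n x,
         (N0 <= n)%N -> `|x| < R0 ->
         `|g x n - (Num.sqrt (2 * pi))^-1| <= eps).

Definition sup_f (f : R -> R) : R := sup (range f).
Definition sup_g (g : R -> nat -> R) : R :=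
  sup [set r | exists x n, r = g x n].
Definition sup_lam (lam : nat -> R -> R) : R :=
  sup [set r | exists n u, (1 <= n)%N /\ 0 < u /\ r = `|lam n u|].
Definition C_eps (eps : R) : R :=
  sup [set r | exists x, 1 <= x /\ r = ln x / powR x eps].

Definition M_Phi (f Phi : R -> R) (beta : R) : \bar R :=
  (\int[leb]_v (powR (Phi v) (1 + beta) * f v)%:E)%E.

Definition M_avg (f Phi : R -> R) (beta : R) : \bar R :=
  (\int[leb]_v1 \int[leb]_v2
     ((\int[leb]_(theta in `[0%R, (2 * pi)%R]%classic)
         (powR (Phi (v1 * cos theta + v2 * sin theta)) (1 + beta))%:E)
      * (f v1 * f v2)%:E))%E.

Definition C_const (f Phi : R -> R) (g : R -> nat -> R) (lam : nat -> R -> R)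
  (beta eps : R) : R :=
  powR
   (powR 2 (1 + 2 * beta)%R * Num.sqrt 3
    * ((sup_g g + sup_lam lam) / ((Num.sqrt (2 * pi))^-1 - sup_lam lam))
    * (2 * powR (C_eps eps * powR (sup_f f) eps) (1 + beta)
       + fine (M_Phi f Phi beta) + fine (M_avg f Phi beta)))
   (1 + beta)^-1.

End Defs.

(* Main.v *)
Require Import Defs.
From HB Require Import structures.
From mathcomp Require Import all_boot all_order all_algebra.
From mathcomp Require Import all_classical all_reals all_analysis.
From mathcomp Require Import measurable_realfun ring lra.
Set Implicit Arguments. Unset Strict Implicit. Unset Printing Implicit Defensive.
Import Order.TTheory GRing.Theory Num.Theory.
Import numFieldNormedType.Exports.
Local Open Scope classical_set_scope.
Local Open Scope ring_scope.

(** On the set where F >= F o R the factor |F - F o R| is at most F, and there the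
    logarithm of the quotient is at most
    log f(v1) + log f(v2) + Phi(v1') + Phi(v2'), where (v1', v2') is the rotated pair and
    log f <= C_eps ||f||^eps; on the complement the roles of the two points are exchanged.
    By convexity of the power 1 + beta, psi_beta(F, F o R) is dominated by
    h(v1, v2) f(v3) ... f(vN) / Z_N for an explicit h.
    For such integrands, polar coordinates in (v3, ..., vN) express the sphere integral
    through Z_{N-2}, and g-concentration bounds it by
    sqrt(N / (N-2)) (||g|| + sup |lam|) / ((2 pi)^{-1/2} - sup |lam|) times the plane
    integral of h. Since Lebesgue measure on the plane is rotation invariant and the angular
    average is invariant under shifts and reflections of theta, the plane integral of h is
    controlled by M_avg after averaging over theta. *)

(** * Measurability and change of variables on the line *)

(** The sphere average is a cone measure, that is, an integral over the unit ball of a function of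
    the direction. The slicing formula is therefore derived inside the ball, from one-dimensional
    substitutions and Tonelli alone, and the norm of the whole vector is integrated out at the end.
    Concentration is used in two different ways. Z_{N-2} is met at every radius below sqrt N, so
    only the suprema of g and |lam| can bound it. Z_N is met only at radius sqrt N, where the
    argument of g is 0 and its value (2 pi)^{-1/2} is exact; this gives the denominator. Surface
    areas and powers of the radius then cancel in the quotient. In the constant, 2^{2 beta} is the
    price of convexity for four summands, the remaining factor 2 comes from adding the bounds of the
    two cases F >= F o R and F <= F o R, and sqrt 3 is the value of sqrt(N / (N-2)) at N = 3. *)

Lemma le_integral_ge0 d (T : measurableType d) (R : realType)
    (mu : {measure set T -> \bar R}) (D : set T) (f1 f2 : T -> \bar R) :
  (forall x, D x -> (0 <= f1 x)%E) -> (forall x, D x -> (f1 x <= f2 x)%E) ->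
  (\int[mu]_(x in D) f1 x <= \int[mu]_(x in D) f2 x)%E.
Proof.
move=> f10 f12.
have f20 x : D x -> (0 <= f2 x)%E.
  by move=> Dx; exact: le_trans (f10 _ Dx) (f12 _ Dx).
(* The integral of a nonnegative function is a supremum over the simple functions below it, which is
   monotone for arbitrary functions. Inequalities can thus be integrated where measurability of the
   smaller side is not at hand, as for the sphere integral of [psi] as a function of the angle. *)
rewrite !ge0_integralE//.
apply: le_ereal_sup => _ [h hf <-].
exists h => // x.
by apply: le_trans (hf x) _; rewrite /patch; case: ifPn => // /set_mem; exact: f12.
Qed.

Section measurability.
Context d (T : measurableType d) (R : realType).
Implicit Types (f g : T -> R) (b c : T -> bool).

Lemma mfun_add f g : measurable_fun setT f -> measurable_fun setT g ->
  measurable_fun setT (fun x => f x + g x).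
Proof. exact: measurable_funD. Qed.

Lemma mfun_sub f g : measurable_fun setT f -> measurable_fun setT g ->
  measurable_fun setT (fun x => f x - g x).
Proof. exact: measurable_funB. Qed.

Lemma mfun_opp f : measurable_fun setT f -> measurable_fun setT (fun x => - f x).
Proof. by move=> mf; exact: (measurableT_comp (@oppr_measurable _ _)). Qed.

Lemma mfun_mul f g : measurable_fun setT f -> measurable_fun setT g ->
  measurable_fun setT (fun x => f x * g x).
Proof. exact: measurable_funM. Qed.

Lemma mfun_exp n f : measurable_fun setT f -> measurable_fun setT (fun x => f x ^+ n).
Proof. exact: measurable_funX. Qed.

Lemma mfun_powR p f : measurable_fun setT f ->
  measurable_fun setT (fun x => powR (f x) p).
Proof. by move=> mf; exact: (measurableT_comp (measurable_powR _)). Qed.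

Lemma mfun_inv f : measurable_fun setT f -> measurable_fun setT (fun x => (f x)^-1).
Proof.
(* [powR _ (-1)] agrees with the inverse on nonnegative arguments only, hence the square; both sides
   are 0 where [f] vanishes. *)
move=> mf; rewrite [X in measurable_fun _ X](_ : _ =
    fun x => f x * powR (f x ^+ 2) (-1)); last first.
  apply/funext => x; rewrite powR_inv1 ?sqr_ge0//.
  have [->|fx0] := eqVneq (f x) 0; first by rewrite invr0 mul0r.
  by rewrite expr2 invfM mulrA divff ?mul1r.
by apply: mfun_mul => //; apply: mfun_powR; exact: mfun_exp.
Qed.

Lemma mfun_sqrt f : measurable_fun setT f ->
  measurable_fun setT (fun x => Num.sqrt (f x)).
Proof.
move=> mf; apply: (measurableT_comp _ mf).
by apply: continuous_measurable_fun => x; exact: sqrt_continuous.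
Qed.

Lemma mfun_norm f : measurable_fun setT f -> measurable_fun setT (fun x => `|f x|).
Proof. by move=> mf; exact: (measurableT_comp (@normr_measurable _ _)). Qed.

Lemma mfun_cos f : measurable_fun setT f -> measurable_fun setT (fun x => cos (f x)).
Proof.
move=> mf; apply: (measurableT_comp _ mf).
by apply: continuous_measurable_fun => x; exact: continuous_cos.
Qed.

Lemma mfun_sin f : measurable_fun setT f -> measurable_fun setT (fun x => sin (f x)).
Proof.
move=> mf; apply: (measurableT_comp _ mf).
by apply: continuous_measurable_fun => x; exact: continuous_sin.
Qed.

Lemma mfun_lt f g : measurable_fun setT f -> measurable_fun setT g ->
  measurable_fun setT (fun x => f x < g x).
Proof. exact: measurable_fun_ltr. Qed.

Lemma mfun_le f g : measurable_fun setT f -> measurable_fun setT g ->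
  measurable_fun setT (fun x => f x <= g x).
Proof. exact: measurable_fun_ler. Qed.

Lemma mfun_and b c : measurable_fun setT b -> measurable_fun setT c ->
  measurable_fun setT (fun x => b x && c x).
Proof. exact: measurable_and. Qed.

Lemma mfun_if b f g : measurable_fun setT b -> measurable_fun setT f ->
  measurable_fun setT g -> measurable_fun setT (fun x => if b x then f x else g x).
Proof. exact: measurable_fun_ifT. Qed.

Lemma mfun_bool b : measurable_fun setT b ->
  measurable_fun setT (fun x => (b x)%:R : R).
Proof.
move=> mb; rewrite [X in measurable_fun _ X](_ : _ =
    fun x => if b x then 1 else 0 : R).
  by apply: mfun_if => //; exact: measurable_cst.
by apply/funext => x; case: (b x).
Qed.

End measurability.

Lemma mfun_fst d d1 d2 (T : measurableType d) (T1 : measurableType d1)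
    (T2 : measurableType d2) (f : T -> T1 * T2) :
  measurable_fun setT f -> measurable_fun setT (fun x => (f x).1).
Proof. exact: measurableT_comp. Qed.

Lemma mfun_snd d d1 d2 (T : measurableType d) (T1 : measurableType d1)
    (T2 : measurableType d2) (f : T -> T1 * T2) :
  measurable_fun setT f -> measurable_fun setT (fun x => (f x).2).
Proof. exact: measurableT_comp. Qed.

Lemma mfun_comp d d1 d2 (T : measurableType d) (T1 : measurableType d1)
    (T2 : measurableType d2) (g : T1 -> T2) (f : T -> T1) :
  measurable_fun setT g -> measurable_fun setT f ->
  measurable_fun setT (fun x => g (f x)).
Proof. exact: measurableT_comp. Qed.

Ltac mfun :=
  repeat lazymatch goal with
  | H : measurable_fun setT ?f |- measurable_fun setT ?f => exact: H
  | |- measurable_fun setT (fun=> ?c) => exact: measurable_cst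
  | |- measurable_fun setT (fun x => (@?f x)%:E) => apply/measurable_EFinP
  | |- measurable_fun setT (fun x => (nat_of_bool (@?f x))%:R) => apply: mfun_bool
  | |- measurable_fun setT (fun x => @?f x - @?g x) => apply: mfun_sub
  | |- measurable_fun setT (fun x => @?f x + @?g x) => apply: mfun_add
  | |- measurable_fun setT (fun x => - @?f x) => apply: mfun_opp
  | |- measurable_fun setT (fun x => @?f x * @?g x) => apply: mfun_mul
  | |- measurable_fun setT (fun x => @?f x ^+ ?n) => apply: mfun_exp
  | |- measurable_fun setT (fun x => (@?f x)^-1) => apply: mfun_inv
  | |- measurable_fun setT (fun x => powR (@?f x) ?p) => apply: mfun_powR
  | |- measurable_fun setT (fun x => Num.sqrt (@?f x)) => apply: mfun_sqrt
  | |- measurable_fun setT (fun x => `|@?f x|) => apply: mfun_norm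
  | |- measurable_fun setT (fun x => cos (@?f x)) => apply: mfun_cos
  | |- measurable_fun setT (fun x => sin (@?f x)) => apply: mfun_sin
  | |- measurable_fun setT (fun x => @?f x < @?g x) => apply: mfun_lt
  | |- measurable_fun setT (fun x => @?f x <= @?g x) => apply: mfun_le
  | |- measurable_fun setT (fun x => @?f x && @?g x) => apply: mfun_and
  | |- measurable_fun setT (fun x => x) => exact: measurable_id
  | |- measurable_fun setT (fun x => fst (@?f x)) => apply: mfun_fst
  | |- measurable_fun setT (fun x => snd (@?f x)) => apply: mfun_snd
  | |- measurable_fun setT (fun x => (@?f x, @?g x)) => apply: measurable_fun_pair
  | H : forall i, measurable_fun setT (fun t => @?e i t) |- measurable_fun setT (fun t => _ t _) => exact: H
  | H : measurable_fun setT ?f |- measurable_fun setT (fun x => ?f (@?g x)) =>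
      apply: (mfun_comp H)
  | |- @measurable_fun _ _ ?A _ setT ?f =>
      lazymatch f with
      | (fun _ => _) => fail
      | _ => change (measurable_fun setT (fun x : A => f x))
      end
  end.

Lemma ge0_integral_mrestr d (T : measurableType d) (R : realType)
    (mu : {measure set T -> \bar R}) (E : set T) (mE : measurable E)
    (f : T -> \bar R) :
  measurable_fun setT f -> (forall x, (0 <= f x)%E) ->
  (\int[mrestr mu mE]_x f x = \int[mu]_(x in E) f x)%E.
Proof.
move=> mf f0; rewrite -(setUv E) ge0_integral_setU//=; last 3 first.
  exact: measurableC.
  by rewrite setUv.
  by rewrite disj_set2E setICr.
rewrite (@eq_measure_integral _ _ _ E mu (mrestr mu mE)); last first.
  by move=> A mA AE; rewrite /= /mrestr setIidl.
rewrite (@eq_measure_integral _ _ _ (~` E) mzero (mrestr mu mE)); last first.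
  move=> A mA AE; rewrite /= /mrestr.
  by rewrite (_ : A `&` E = set0) ?measure0//; apply/seteqP; split => // x [/AE].
by rewrite integral_measure_zero adde0.
Qed.

Lemma integral_ind_itv (R : realType) (b1 b2 : bool) (x y : R) : x <= y ->
  (\int[lebesgue_measure]_z
     (z \in Interval (BSide b1 x) (BSide b2 y))%:R%:E = (y - x)%:E)%E.
Proof.
move=> xy.
transitivity (\int[lebesgue_measure]_z
   (\1_([set` Interval (BSide b1 x) (BSide b2 y)] : set R) z)%:E)%E.
  by apply: eq_integral => z _; rewrite indicE mem_setE.
rewrite integral_indic//= setIT lebesgue_measure_itv/= lte_fin.
by case: ltP => // yx; rewrite (@le_anti _ _ x y) ?subrr// xy yx.
Qed.

Section change_of_variables.
Variable R : realType.
Notation leb := (@lebesgue_measure R).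

(* The measure with density [w] is realised as the projection of planar Lebesgue
   measure restricted to the subgraph of [w]. *)
Lemma integral_change_of_variables (w T : R -> R) (phi : R -> \bar R) :
  measurable_fun setT w -> (forall x, 0 <= w x) -> measurable_fun setT T ->
  (forall a b, a < b ->
    (\int[leb]_x (w x * (a < T x <= b)%R%:R)%:E = (b - a)%:E)%E) ->
  measurable_fun setT phi -> (forall x, (0 <= phi x)%E) ->
  (\int[leb]_x ((w x)%:E * phi (T x)) = \int[leb]_x phi x)%E.
Proof.
move=> mw w0 mT Hab mphi phi0.
pose b (p : R * R) := (0 <= p.2 < w p.1)%R.
have mb : measurable_fun setT b by rewrite /b; mfun.
pose E := [set p | b p].
have mE : measurable E.
  by rewrite -[E]setTI; exact: (mb measurableT [set true]).
pose prj (p : R * R) := T p.1.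
have mprj : measurable_fun setT prj by rewrite /prj; mfun.
pose m : {measure set (measurableTypeR R) -> \bar R} :=
  measure_function_pushforward__canonical__measure_function_Measure
    (mrestr (leb \x leb)%E mE) (mprj : measurable_fun setT (prj : _ -> measurableTypeR R)).
have intm psi : measurable_fun setT psi -> (forall x, (0 <= psi x)%E) ->
   (\int[m]_x psi x = \int[leb]_x ((w x)%:E * psi (T x)))%E.
  move=> mpsi psi0; rewrite ge0_integral_pushforward//=.
  rewrite preimage_setT ge0_integral_mrestr//; last exact: measurableT_comp.
  rewrite integral_mkcond.
  transitivity (\int[leb \x leb]_p ((psi (prj p)) * (b p)%:R%:E))%E.
    apply: eq_integral => p _; rewrite /patch.
    rewrite (_ : (p \in E) = b p); last by apply/idP/idP; rewrite inE.
    by case: (b p); rewrite ?mule1 ?mule0.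
  rewrite fubini_tonelli1//; last 2 first.
    apply: emeasurable_funM; first exact: measurableT_comp.
    by apply/measurable_EFinP; apply: mfun_bool; exact: mb.
    by move=> p; rewrite mule_ge0// lee_fin.
  apply: eq_integral => x _; rewrite /fubini_F /prj/=.
  rewrite ge0_integralZl//; last first.
    have mby : measurable_fun setT (fun y : R => (b (x, y))%:R%:E : \bar R).
      by rewrite /b/=; mfun.
    exact: mby.
  rewrite muleC; congr (_ * _)%E.
  by have := @integral_ind_itv R true true _ _ (w0 x); rewrite subr0.
(* By uniqueness of Lebesgue measure it is enough that [m] gives each interval []x, y]] its length,
   and that is the hypothesis [Hab]. *)
rewrite -intm//; apply: eq_measure_integral => A mA _.
rewrite -(@lebesgue_measure_unique _ m)// => _ [[x y] _ <-] /=.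
have -> : m `]x, y]%classic = (\int[m]_z (\1_(`]x, y]%classic : set R) z)%:E)%E.
  by rewrite integral_indic// setIT.
rewrite intm//; last first.
  have : measurable_fun setT (fun z => (\1_(`]x, y]%classic : set R) z)%:E : \bar R).
    by apply/measurable_EFinP; exact: measurable_indic.
  exact.
rewrite [RHS](_ : _ = \int[leb]_z (w z * (x < T z <= y)%R%:R)%:E)%E; last first.
  by apply: eq_integral => z _; rewrite indicE mem_setE/= in_itv.
rewrite lebesgue_measure_itv/= lte_fin; case: ltP => [xy|yx]; first by rewrite Hab.
rewrite integral0_eq// => z _; case: ltP => //= xT; last by rewrite mulr0.
by rewrite leNgt (le_lt_trans yx xT)/= mulr0.
Qed.
End change_of_variables.

(** * Integrals of powers *)

Section powers.
Variable R : realType.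
Notation leb := (@lebesgue_measure R).

Lemma is_derive_expn n (x : R) :
  is_derive x 1 (fun y : R => y ^+ n.+1) (n.+1%:R * x ^+ n).
Proof.
have := @is_deriveX R R id n.+1 x 1 1 (is_derive_id _ _).
by rewrite /GRing.scale/= mulr1 exprfctE.
Qed.

Lemma continuous_expn n : continuous (fun y : R => y ^+ n).
Proof.  by move=> x; exact: exprn_continuous. Qed.

Lemma integral_expn n (a b : R) : a <= b ->
  (\int[leb]_x ((a < x <= b)%R%:R * (n.+1%:R * x ^+ n))%:E
    = (b ^+ n.+1 - a ^+ n.+1)%:E)%E.
Proof.
rewrite le_eqVlt => /predU1P[<-|ab].
  rewrite subrr integral0_eq// => x _.
  by case: ltP => //= ax; rewrite ?leNgt ?ax mul0r.
have cF : continuous (fun y : R => y ^+ n.+1) by exact: continuous_expn.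
transitivity (\int[leb]_(x in `]a, b]) (n.+1%:R * x ^+ n)%:E)%E.
  rewrite [RHS]integral_mkcond; apply: eq_integral => x _; rewrite /patch mem_setE/= in_itv/=.
  by case: ifP; rewrite ?mul1r ?mul0r.
rewrite integral_itv_obnd_cbnd; last first.
  apply: measurable_funTS; by mfun.
rewrite (@continuous_FTC2 _ _ (fun x : R => x ^+ n.+1))//.
- apply: continuous_subspaceT => x.
  apply: cvgM; first exact: cvg_cst.
  exact: continuous_expn.
- split.
  + by move=> x _; have [] := is_derive_expn n x.
  + exact: cvg_at_right_filter (cF a).
  + exact: cvg_at_left_filter (cF b).
- by move=> x _; rewrite derive1E; have [_ ->] := is_derive_expn n x.
Qed.

Lemma is_derive_invn n (x : R) : 0 < x ->
  is_derive x 1 (fun y : R => - (y ^- n.+1)) (n.+1%:R * x ^- n.+2).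
Proof.
move=> x0.
have x1 : x ^+ n.+1 != 0 by rewrite expf_neq0// gt_eqF.
have HV := @is_deriveV R (fun y => y ^+ n.+1) x _ 1 x1 (is_derive_expn n x).
apply: (is_derive_eq (is_deriveN HV)).
rewrite /GRing.scale/= mulNr opprK.
rewrite mulrCA; congr (_ * _).
rewrite -exprM (_ : (n.+1 * 2 = n.+2 + n)%N); last by rewrite muln2 -addnn -addSnnS.
by rewrite exprD invfM mulfVK// expf_neq0// gt_eqF.
Qed.

Lemma integral_invn n (a : R) : 0 < a ->
  (\int[leb]_x ((a < x)%R%:R * (n.+1%:R * x ^- n.+2))%:E = (a ^- n.+1)%:E)%E.
Proof.
move=> a0.
transitivity (\int[leb]_(x in `]a, +oo[) (n.+1%:R * x ^- n.+2)%:E)%E.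
  rewrite [RHS]integral_mkcond; apply: eq_integral => x _; rewrite /patch mem_setE/= in_itv/= andbT.
  by case: ifP; rewrite ?mul1r ?mul0r.
rewrite integral_itv_obnd_cbnd; last first.
  apply: measurable_funTS; by mfun.
have cV x m : 0 < x -> {for x, continuous (fun x : R => x ^- m)}.
  move=> x0; apply: continuousV; last exact: continuous_expn.
  by rewrite expf_neq0// gt_eqF.
rewrite (@ge0_continuous_FTC2y _ _ (fun x : R => - (x ^- n.+1)) _ 0).
- by rewrite sub0e -EFinN opprK.
- by move=> x ax; rewrite mulr_ge0// invr_ge0 exprn_ge0// ltW// (lt_le_trans a0).
- apply: continuous_in_subspaceT => x; rewrite inE/= in_itv/= andbT => ax.
  apply: cvgM; first exact: cvg_cst.
  apply: cV. exact: lt_le_trans ax.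
- rewrite -oppr0; apply: cvgN.
  apply/gtr0_cvgV0.
    by near=> x; apply: exprn_gt0; near: x; apply: nbhs_pinfty_gt; exact: num_real.
  apply/cvgryPge => A; near=> x.
  have x1 : 1 <= x by near: x; apply: nbhs_pinfty_ge; exact: num_real.
  apply: (@le_trans _ _ x); first by near: x; apply: nbhs_pinfty_ge; exact: num_real.
  by rewrite exprS ler_peMr ?(le_trans ler01)// exprn_ege1.
- by move=> x ax; have [] := is_derive_invn n (lt_trans a0 ax).
- apply: cvg_at_right_filter. apply: cvgN. exact: cV.
- move=> x; rewrite in_itv/= andbT => ax.
  by rewrite derive1E; have [_ ->] := is_derive_invn n (lt_trans a0 ax).
Unshelve. all: by end_near. Qed.
End powers.

(** * Affine and quadratic substitutions *)

Section substitutions.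
Variable R : realType.
Notation leb := (@lebesgue_measure R).
Implicit Type phi : R -> \bar R.

Lemma integral_affine (a c : R) phi : a != 0 ->
  measurable_fun setT phi -> (forall x, (0 <= phi x)%E) ->
  (\int[leb]_x (`|a|%:E * phi (a * x + c)%R) = \int[leb]_x phi x)%E.
Proof.
move=> a0 mphi phi0.
apply: (@integral_change_of_variables _ (fun=> `|a|)) => //; try by mfun.
move=> x y xy.
under eq_integral do rewrite EFinM.
rewrite ge0_integralZl//; last first.
  have : measurable_fun setT (fun z : R => (x < a * z + c <= y)%R%:R%:E : \bar R) by mfun.
  exact.
have [ap|an] := ltP 0 a.
  rewrite [X in (_ * X)%E](_ : _ =
    \int[leb]_z (z \in `]((x - c) / a)%R, ((y - c) / a)%R])%:R%:E)%E.
    rewrite integral_ind_itv; last by rewrite ler_pM2r ?invr_gt0// lerD2r ltW.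
    by rewrite -EFinM gtr0_norm//; congr (_%:E); field.
  apply: eq_integral => z _; rewrite in_itv/= ltr_pdivrMr// ler_pdivlMr//.
  by rewrite ltrBlDr lerBrDr mulrC.
have {}an : a < 0 by rewrite lt_neqAle a0.
rewrite [X in (_ * X)%E](_ : _ =
  \int[leb]_z (z \in `[((y - c) / a)%R, ((x - c) / a)%R[)%:R%:E)%E.
  rewrite integral_ind_itv; last by rewrite ler_nM2r ?invr_lt0// lerD2r ltW.
  by rewrite -EFinM ltr0_norm//; congr (_%:E); field.
apply: eq_integral => z _; rewrite in_itv/= ler_ndivrMr// ltr_ndivlMr//.
by rewrite ltrBlDr lerBrDr mulrC andbC.
Qed.

Lemma integral_scale (a : R) phi : 0 < a ->
  measurable_fun setT phi -> (forall x, (0 <= phi x)%E) ->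
  (\int[leb]_x phi (a * x)%R = a^-1%:E * \int[leb]_x phi x)%E.
Proof.
move=> a0 mphi phi0.
rewrite -(@integral_affine a 0 phi) ?gt_eqF// gtr0_norm//.
rewrite ge0_integralZl//; last 2 first.
  have : measurable_fun setT (fun z : R => phi (a * z + 0)) by mfun.
  exact.
  by rewrite lee_fin ltW.
rewrite muleA -EFinM mulVf ?gt_eqF// mul1e.
by apply: eq_integral => x _; rewrite addr0.
Qed.

Lemma integral_shift (c : R) phi :
  measurable_fun setT phi -> (forall x, (0 <= phi x)%E) ->
  (\int[leb]_x phi (x + c)%R = \int[leb]_x phi x)%E.
Proof.
move=> mphi phi0.
rewrite -(@integral_affine 1 c phi) ?oner_eq0//.
by apply: eq_integral => x _; rewrite normr1 mul1e mul1r.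
Qed.

Lemma integral_reflect (c : R) phi :
  measurable_fun setT phi -> (forall x, (0 <= phi x)%E) ->
  (\int[leb]_x phi (c - x)%R = \int[leb]_x phi x)%E.
Proof.
move=> mphi phi0.
rewrite -(@integral_affine (-1) c phi) ?oppr_eq0 ?oner_eq0//.
by apply: eq_integral => x _; rewrite normrN1 mul1e mulN1r addrC.
Qed.

Lemma integral_sqr phi :
  measurable_fun setT phi -> (forall x, (0 <= phi x)%E) ->
  (\int[leb]_r (((0 < r)%R%:R * (2 * r))%:E * phi (r ^+ 2)%R) =
   \int[leb]_u ((0 < u)%R%:R%:E * phi u))%E.
Proof.
move=> mphi phi0.
(* The change of variables needs a map of the whole line onto itself, so squaring is continued by
   the identity on the nonpositive half-line, where the factor [0 < u] kills the integrand. *)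
rewrite -[RHS](@integral_change_of_variables _
  (fun r => if 0 < r then 2 * r else 1) (fun r => if 0 < r then r ^+ 2 else r)).
- apply: eq_integral => r _; case: ifPn => r0.
    by rewrite exprn_gt0// mul1r mul1e.
  by rewrite (negbTE r0) mul0r !mul0e mule0.
- by apply: mfun_if; mfun.
- by move=> r; case: ifPn => // r0; rewrite mulr_ge0// ltW.
- by apply: mfun_if; mfun.
- move=> a b ab.
  (* The preimage of []a, b]] has a nonpositive and a positive piece. As [Num.sqrt] is 0 on negative
     numbers, [Num.min x 0 + Num.sqrt x ^+ 2 = x] holds for every sign, and the two lengths add up
     to [b - a]. *)
  rewrite [LHS](_ : _ = \int[leb]_x
      ((Num.min a 0 < x <= Num.min b 0)%R%:R%:E
       + ((Num.sqrt a < x <= Num.sqrt b)%R%:R * (2%:R * x ^+ 1))%:E))%E.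
    rewrite ge0_integralD//; last 3 first.
    + have : measurable_fun setT (fun x : R => (Num.min a 0 < x <= Num.min b 0)%R%:R%:E : \bar R) by mfun.
      exact.
    + move=> x _; rewrite lee_fin.
      case: ltP => [xa|]; last by rewrite mul0r.
      by rewrite mulr_ge0// mulr_ge0// expr1 ltW// (le_lt_trans (sqrtr_ge0 a)).
    + have : measurable_fun setT (fun x : R => ((Num.sqrt a < x <= Num.sqrt b)%R%:R * (2%:R * x ^+ 1))%:E : \bar R) by mfun.
      exact.
    rewrite integral_expn; last by rewrite ler_wsqrtr// ltW.
    have min_le : Num.min a 0 <= Num.min b 0.
      by rewrite le_min !ge_min lexx (ltW ab) orbT.
    rewrite [X in (X + _)%E](_ : _ = (Num.min b 0 - Num.min a 0)%:E); last first.
      rewrite -(@integral_ind_itv R false false _ _ min_le).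
      by apply: eq_integral => x _; rewrite in_itv.
    rewrite -EFinD; congr (_%:E).
    have sm (x : R) : Num.min x 0 + Num.sqrt x ^+ 2 = x.
      case: leP => x0; last by rewrite add0r sqr_sqrtr// ltW.
      by rewrite ler0_sqrtr// expr0n addr0.
    by rewrite -[in RHS](sm a) -[in RHS](sm b); ring.
  apply: eq_integral => r _; rewrite -EFinD; congr (_%:E).
  case: ifPn => [r0|].
    have -> : (Num.min a 0 < r <= Num.min b 0) = false.
      by rewrite le_min (leNgt r 0) r0 !andbF.
    rewrite add0r expr1 mulrC; congr (_ %:R * _).
    have -> : (a < r ^+ 2) = (Num.sqrt a < r).
      have [a0|a0] := leP 0 a.
        by rewrite -[r in RHS]ger0_norm ?(ltW r0)// -sqrtr_sqr ltr_sqrt// exprn_gt0.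
      by rewrite ltr0_sqrtr// r0 (lt_trans a0)// exprn_gt0.
    congr (_ && _); have [b0|b0] := leP 0 b.
      by rewrite -[r in RHS]ger0_norm ?(ltW r0)// -sqrtr_sqr ler_sqrt.
    have br : b < r ^+ 2 by rewrite (lt_trans b0)// exprn_gt0.
    by rewrite ltr0_sqrtr// !leNgt r0 br.
  rewrite -leNgt => r0.
  have -> : (Num.sqrt a < r <= Num.sqrt b) = false.
    by rewrite ltNge (le_trans r0).
  by rewrite mul1r mul0r addr0 gt_min le_min r0 andbT (ltNge 0 r) r0 orbF.
- apply: emeasurable_funM => //.
  by mfun.
- by move=> x; rewrite mule_ge0// lee_fin.
Qed.

(** With s^2 = a + r^2 one has r dr = s ds: pass to u = r^2, shift by [a], and return to s. It later
    trades the radius of the last coordinates for the norm of the whole vector. *)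
Lemma integral_hypot (a : R) phi : 0 <= a ->
  measurable_fun setT phi -> (forall x, (0 <= phi x)%E) ->
  (\int[leb]_r (((0 < r)%R%:R * r)%:E * phi (Num.sqrt (a + r ^+ 2)%R)) =
   \int[leb]_s (((Num.sqrt a < s)%R%:R * s)%:E * phi s))%E.
Proof.
move=> a0 mphi phi0.
pose half x : \bar R := (2^-1%:E * phi x)%E.
have mhalf : measurable_fun setT half by apply: measurable_funeM.
have half0 x : (0 <= half x)%E by rewrite mule_ge0// lee_fin.
have phiE x y : (x%:E * phi y = (2 * x)%:E * half y)%E.
  by rewrite /half muleA -EFinM mulrAC divff// mul1r.
transitivity (\int[leb]_u ((0 < u)%R%:R%:E * half (Num.sqrt (a + u)%R)))%E.
  rewrite -(@integral_sqr (fun u => half (Num.sqrt (a + u)%R))) //; last by mfun.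
  by apply: eq_integral => r _; rewrite phiE mulrCA.
transitivity (\int[leb]_u ((a < u)%R%:R%:E * half (Num.sqrt u)))%E.
  rewrite -[RHS](@integral_shift a).
  - by apply: eq_integral => u _; rewrite ltrDr addrC.
  - apply: emeasurable_funM; by mfun.
  - by move=> x; rewrite mule_ge0// lee_fin.
transitivity (\int[leb]_u ((0 < u)%R%:R%:E * ((a < u)%R%:R%:E * half (Num.sqrt u))))%E.
  apply: eq_integral => u _; case: (ltP 0 u) => u0; first by rewrite mul1e.
  by rewrite ltNge (le_trans u0 a0)/= !mul0e.
rewrite -integral_sqr; first last.
- by move=> x; rewrite mule_ge0// lee_fin.
- apply: emeasurable_funM; by mfun.
apply: eq_integral => s _; rewrite phiE.
have [s0|s0] := ltP 0 s.
  rewrite sqrtr_sqr gtr0_norm// mul1r muleA -EFinM; congr (_%:E * _)%E.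
  rewrite mulrCA [RHS]mulrC; congr (_ * _ %:R).
  by rewrite -[s in RHS]ger0_norm ?(ltW s0)// -sqrtr_sqr ltr_sqrt// exprn_gt0.
by rewrite mul0r mul0e ltNge (le_trans s0 (sqrtr_ge0 a)) /= mul0r mulr0 mul0e.
Qed.

End substitutions.

(** * Iterated integrals and polar coordinates *)

Section iterated.
Variable R : realType.
Notation leb := (@lebesgue_measure R).
Implicit Types (F G : (nat -> R) -> \bar R).

(* [nat -> R] carries no sigma-algebra here: measurability of a function on it is
   tested along all coordinatewise measurable maps into it. *)
Definition vmeasurable F : Prop :=
  forall d (T : measurableType d) (e : T -> nat -> R),
    (forall i, measurable_fun setT (fun t => e t i)) ->
    measurable_fun setT (fun t => F (e t)).

Definition pmeasurable d (T : measurableType d) (F : T -> (nat -> R) -> \bar R) : Prop :=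
  forall d' (T' : measurableType d') (p : T' -> T) (e : T' -> nat -> R),
    measurable_fun setT p -> (forall i, measurable_fun setT (fun t => e t i)) ->
    measurable_fun setT (fun t => F (p t) (e t)).

Lemma pmeasurable_vmeasurable d (T : measurableType d) (F : T -> (nat -> R) -> \bar R) t :
  pmeasurable F -> vmeasurable (F t).
Proof.
by move=> mF d' T' e me; apply: (mF _ _ (fun=> t)) => //; exact: measurable_cst.
Qed.

Lemma measurable_scons d (T : measurableType d) (x : T -> R) (e : T -> nat -> R) :
  measurable_fun setT x -> (forall i, measurable_fun setT (fun t => e t i)) ->
  forall i, measurable_fun setT (fun t => scons (x t) (e t) i).
Proof. by move=> mx me [|i] //=. Qed.

Lemma vmeasurable_scons F : vmeasurable F ->
  pmeasurable (fun (x : R) v => F (scons x v)).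
Proof. by move=> mF d T p e mp me; apply: mF; exact: measurable_scons. Qed.

Lemma iint_ge0 n F : (forall v, (0 <= F v)%E) -> (0 <= iint n F)%E.
Proof.
by elim: n F => [|n IH] F F0 //=; apply: integral_ge0 => x _; apply: IH.
Qed.

(** The parameter space varies in the induction: each integration variable first joins it as a
    factor of a product, and is then integrated out by Tonelli. *)
Lemma measurable_iint n d (T : measurableType d) (F : T -> (nat -> R) -> \bar R) :
  (forall t v, (0 <= F t v)%E) -> pmeasurable F ->
  measurable_fun setT (fun t => iint n (F t)).
Proof.
elim: n d T F => [|n IH] d T F F0 mF /=.
  by apply: (mF _ _ id) => // i; exact: measurable_cst.
apply: (@measurable_fun_fubini_tonelli_F _ _ T (measurableTypeR R) R leb
  (fun p => iint n (fun v => F p.1 (scons p.2 v)))).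
- apply: (IH _ _ (fun (p : T * measurableTypeR R) v => F p.1 (scons p.2 v))) => //.
  move=> d' T' p e mp me; apply: (mF _ _ (fun t => (p t).1)); first by mfun.
  apply: measurable_scons => //.
  exact: (mfun_snd mp).
- by move=> p; exact: iint_ge0.
Qed.

Lemma le_iint n F G : (forall v, (0 <= F v)%E) -> (forall v, (F v <= G v)%E) ->
  (iint n F <= iint n G)%E.
Proof.
elim: n F G => [|n IH] F G F0 FG //=.
apply: le_integral_ge0 => x _; first exact: iint_ge0.
exact: IH.
Qed.

Lemma eq_iint n F G : (forall v, F v = G v) -> iint n F = iint n G.
Proof. by move=> /funext ->. Qed.

Lemma tonelli (F : R -> R -> \bar R) :
  measurable_fun setT (fun p : R * R => F p.1 p.2) ->
  (forall x y, (0 <= F x y)%E) ->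
  (\int[leb]_x \int[leb]_y F x y = \int[leb]_y \int[leb]_x F x y)%E.
Proof.
move=> mF F0.
exact: (@fubini_tonelli _ _ (measurableTypeR R) (measurableTypeR R) R leb leb
  (fun p => F p.1 p.2)).
Qed.

Lemma iint_tonelli n (F : R -> (nat -> R) -> \bar R) :
  (forall t v, (0 <= F t v)%E) -> pmeasurable F ->
  (\int[leb]_t iint n (F t) = iint n (fun v => \int[leb]_t F t v))%E.
Proof.
elim: n F => [|n IH] F F0 mF //=.
rewrite (tonelli (F := fun t x => iint n (fun v => F t (scons x v)))).
- apply: eq_integral => x _; apply: IH => // d T p e mp me.
  by apply: (mF _ _ p) => //; apply: measurable_scons => //; exact: measurable_cst.
- apply: (@measurable_iint n _ _ (fun (p : R * R) v => F p.1 (scons p.2 v))) => //.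
  move=> d T p e mp me; apply: (mF _ _ (fun t => (p t).1)); first by mfun.
  by apply: measurable_scons => //; exact: (mfun_snd mp).
- by move=> x y; exact: iint_ge0.
Qed.

Lemma measurable_iint_scons n F : (forall v, (0 <= F v)%E) -> vmeasurable F ->
  measurable_fun setT (fun x : R => iint n (fun v => F (scons x v))).
Proof.
move=> F0 mF; apply: measurable_iint => //; exact: vmeasurable_scons.
Qed.

Lemma iintZ n F (k : R) : 0 <= k -> (forall v, (0 <= F v)%E) -> vmeasurable F ->
  iint n (fun v => k%:E * F v)%E = (k%:E * iint n F)%E.
Proof.
move=> k0; elim: n F => [|n IH] F F0 mF //=.
rewrite -ge0_integralZl//.
- apply: eq_integral => x _; rewrite IH//.
  exact: pmeasurable_vmeasurable (vmeasurable_scons mF).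
- exact: measurable_iint_scons.
- by move=> x _; exact: iint_ge0.
Qed.

Lemma vmeasurable_scale F (a : R) : vmeasurable F ->
  vmeasurable (fun v => F (fun i => a * v i)).
Proof. by move=> mF d T e me; apply: mF => i; mfun; exact: me. Qed.

Lemma iint_scale n F (a : R) : 0 < a -> (forall v, (0 <= F v)%E) -> vmeasurable F ->
  iint n (fun v => F (fun i => a * v i)) = ((a ^- n)%:E * iint n F)%E.
Proof.
move=> a0; elim: n F => [|n IH] F F0 mF /=.
  by rewrite expr0 invr1 mul1e; congr F; apply/funext => i; rewrite mulr0.
transitivity (\int[leb]_x ((a ^- n)%:E * iint n (fun v => F (scons (a * x)%R v))))%E.
  apply: eq_integral => x _.
  rewrite -IH//; last exact: pmeasurable_vmeasurable (vmeasurable_scons mF).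
  by apply: eq_iint => v; congr F; apply/funext => -[|i].
have m1 := measurable_iint_scons n F0 mF.
have an0 : (0 <= (a ^- n)%:E)%E by rewrite lee_fin invr_ge0 exprn_ge0// ltW.
rewrite ge0_integralZl//; last 2 first.
  have : measurable_fun setT (fun x : R => iint n (fun v => F (scons (a * x) v))).
    by apply: (mfun_comp m1); mfun.
  exact.
  by move=> x _; exact: iint_ge0.
rewrite (@integral_scale _ a (fun x => iint n (fun v => F (scons x v))))//.
  by rewrite muleA -EFinM -invfM -exprSr.
by move=> x; exact: iint_ge0.
Qed.

Lemma enorm_ge0 n (v : nat -> R) : 0 <= enorm n v.
Proof. exact: sqrtr_ge0. Qed.

Lemma sqr_enorm n (v : nat -> R) : enorm n v ^+ 2 = \sum_(i < n) v i ^+ 2.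
Proof. by rewrite sqr_sqrtr// sumr_ge0// => i _; exact: sqr_ge0. Qed.

Lemma enorm_scons n x (v : nat -> R) :
  enorm n.+1 (scons x v) = Num.sqrt (x ^+ 2 + enorm n v ^+ 2).
Proof. by rewrite sqr_enorm /enorm big_ord_recl. Qed.

Lemma enorm_scale n (a : R) (v : nat -> R) : 0 <= a ->
  enorm n (fun i => a * v i) = a * enorm n v.
Proof.
move=> a0; rewrite /enorm -[a in RHS]ger0_norm// -sqrtr_sqr -sqrtrM ?sqr_ge0//.
by congr Num.sqrt; rewrite mulr_sumr; apply: eq_bigr => i _; rewrite exprMn.
Qed.

Lemma measurable_enorm n d (T : measurableType d) (e : T -> nat -> R) :
  (forall i, measurable_fun setT (fun t => e t i)) ->
  measurable_fun setT (fun t => enorm n (e t)).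
Proof.
move=> me; apply: mfun_sqrt; elim: n => [|n IH].
  by under eq_fun do rewrite big_ord0; exact: measurable_cst.
by under eq_fun do rewrite big_ord_recr/=; apply: mfun_add; [exact: IH|apply: mfun_exp; exact: me].
Qed.

Lemma measurable_tens (f : R -> R) n d (T : measurableType d) (e : T -> nat -> R) :
  measurable_fun setT f ->
  (forall i, measurable_fun setT (fun t => e t i)) ->
  measurable_fun setT (fun t => tens f n (e t)).
Proof.
move=> mf me; rewrite /tens; elim: n => [|n IH].
  by under eq_fun do rewrite big_ord0; exact: measurable_cst.
by under eq_fun do rewrite big_ord_recr/=; apply: mfun_mul; [exact: IH|apply: (mfun_comp mf); exact: me].
Qed.

End iterated.

(** * Cubes and the volume of the unit ball *)

Section ball.
Variable R : realType.
Notation leb := (@lebesgue_measure R).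
Implicit Types (F G : (nat -> R) -> \bar R).

(** Indicator of an open cube, as a product so that its iterated integral factors. *)
Definition box (n : nat) (a : R) (v : nat -> R) : R :=
  \prod_(i < n) (`|v i| < a)%R%:R.

Lemma box_ge0 n a v : 0 <= box n a v.
Proof. by apply: prodr_ge0. Qed.

Lemma vmeasurable_box n a : vmeasurable (fun v => (box n a v)%:E).
Proof.
move=> d T e me; apply/measurable_EFinP; rewrite /box; elim: n => [|n IH].
  by under eq_fun do rewrite big_ord0; exact: measurable_cst.
under eq_fun do rewrite big_ord_recr/=; apply: mfun_mul; first exact: IH.
by mfun; exact: me.
Qed.

Lemma iint_box n (a : R) : 0 <= a -> iint n (fun v => (box n a v)%:E) = ((2 * a) ^+ n)%:E.
Proof.
move=> a0; elim: n => [|n IH] /=; first by rewrite /box big_ord0 expr0.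
transitivity (\int[leb]_x (((2 * a) ^+ n)%:E * (x \in `]-a, a[)%:R%:E))%E.
  apply: eq_integral => x _; rewrite -IH muleC -iintZ//; last 2 first.
    by move=> v; rewrite lee_fin box_ge0.
    exact: vmeasurable_box.
  by apply: eq_iint => v; rewrite /box big_ord_recl/= -EFinM in_itv/= ltr_norml.
rewrite ge0_integralZl//; last 2 first.
  have : measurable_fun setT (fun x : R => (- a < x < a)%R%:R%:E : \bar R) by mfun.
  exact.
  by rewrite lee_fin exprn_ge0// mulr_ge0.
rewrite integral_ind_itv ?ge0_cp// -EFinM opprK.
by congr _%:E; rewrite exprSr; congr (_ * _); ring.
Qed.

Lemma coord_le_enorm n (v : nat -> R) (i : 'I_n) : `|v i| <= enorm n v.
Proof.
rewrite -sqrtr_sqr ler_wsqrtr// (bigD1 i)//= lerDl.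
by apply: sumr_ge0 => j _; exact: sqr_ge0.
Qed.

(** [ball_vol] is defined through [fine], so finiteness has to be shown before it can be divided by.
    The ball lies between the cubes of half-side 1 / (n+1) and 1; the smaller one fits because its
    squared norms are at most n / (n+1). *)
Lemma ball_vol_bounds n : 0 < ball_vol R n /\
  iint n (fun x : nat -> R => (if enorm n x < 1 then 1 else 0)%:E) = (ball_vol R n)%:E.
Proof.
set I := iint n _.
have Iub : (I <= ((2 * 1) ^+ n)%:E)%E.
  rewrite -iint_box//; apply: le_iint => v; rewrite lee_fin; first by case: ifP.
  case: ifPn => [v1|_]; last exact: box_ge0.
  rewrite /box big1// => i _.
  by rewrite (le_lt_trans (coord_le_enorm _ _) v1).
have Ilb : (((2 * n.+1%:R^-1) ^+ n)%:E <= I)%E.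
  rewrite -iint_box//; apply: le_iint => v; rewrite lee_fin; first exact: box_ge0.
  have [/forallP vn|] := boolP [forall i : 'I_n, `|v i| < n.+1%:R^-1]; last first.
    rewrite negb_forall => /existsP[i vi].
    rewrite /box (bigD1 i)//= (negbTE vi) mul0r.
    by case: ifP.
  rewrite ifT; last first.
    rewrite -[X in _ < X]sqrtr1 ltr_sqrt//.
    apply: (@le_lt_trans _ _ (\sum_(i < n) n.+1%:R^-1)).
      apply: ler_sum => i _; rewrite -[X in X <= _]ger0_norm ?sqr_ge0// normrX expr2.
      rewrite -[X in _ <= X]mulr1 ler_pM// ltW//.
      by rewrite (lt_le_trans (vn i))// invf_le1// ler1n.
    rewrite sumr_const card_ord -[X in X < _]mulr_natl ltr_pdivrMr// mul1r ltr_nat//.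
  by rewrite /box big1// => i _; rewrite vn.
have I0 : (0 < I)%E.
  by apply: lt_le_trans Ilb; rewrite lte_fin exprn_gt0// mulr_gt0// invr_gt0.
have Ifin : I \is a fin_num.
  by rewrite ge0_fin_numE ?(ltW I0)// (le_lt_trans Iub)// ltry.
by rewrite /ball_vol -/I fineK// fine_gt0// I0 ltey_eq Ifin.
Qed.

Lemma ball_vol_gt0 n : 0 < ball_vol R n.
Proof. by have [] := ball_vol_bounds n. Qed.

(** The norm is positive off the hyperplane where the first coordinate vanishes, which is null. This
    makes division by the norm harmless in polar coordinates. *)
Lemma iint_neq0 n F : (forall v, (0 <= F v)%E) -> vmeasurable F ->
  iint n.+1 F = iint n.+1 (fun v => (0 < enorm n.+1 v)%R%:R%:E * F v)%E.
Proof.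
move=> F0 mF.
have mF' : vmeasurable (fun v => (0 < enorm n.+1 v)%R%:R%:E * F v)%E.
  move=> d T e me; apply: emeasurable_funM; last exact: mF.
  by mfun; exact: measurable_enorm.
have F'0 v : (0 <= (0 < enorm n.+1 v)%R%:R%:E * F v)%E.
  by rewrite mule_ge0// lee_fin.
rewrite /=; apply: ge0_ae_eq_integral => //.
- exact: measurable_iint_scons.
- exact: (measurable_iint_scons n F'0 mF').
- by move=> x _; exact: iint_ge0.
- by move=> x _; apply: iint_ge0 => v; exact: F'0.
exists [set 0]; split => //; first exact: lebesgue_measure_set1.
move=> x /= Hx; apply: contrapT => x0; apply: Hx => _.
apply: eq_iint => v; rewrite enorm_scons sqrtr_gt0 ltr_pwDl ?sqr_ge0 ?mul1e//.
by rewrite exprn_even_gt0//; apply/eqP.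
Qed.

End ball.
Section polar.
Variable R : realType.
Notation leb := (@lebesgue_measure R).

(* Insert [1 = |y|^m \int_{t > |y|} m t^{-m-1} dt], rescale [y = t x], and then rescale
   [t = r / |x|]. *)
Lemma iint_polar n (K : (nat -> R) -> \bar R) :
  (forall v, (0 <= K v)%E) -> vmeasurable K ->
  iint n.+1 K = (\int[leb]_r (((0 < r)%R%:R * (n.+1%:R * r ^+ n))%:E *
    iint n.+1 (fun x => (0 < enorm n.+1 x < 1)%R%:R%:E *
                        K (fun i => r * x i / enorm n.+1 x)%R)))%E.
Proof.
move=> K0 mK; set m := n.+1.
have men d (T : measurableType d) (e : T -> nat -> R) :
    (forall i, measurable_fun setT (fun t => e t i)) ->
  measurable_fun setT (fun t => enorm m (e t)) by exact: measurable_enorm.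
(* [c1], [c2], [c3] are the kernels after the insertion, after y = t x and after t = r / |x|. The
   first rescaling turns |y| < t into |x| < 1 and t^(-m-1) |y|^m, with its Jacobian t^m, into
   t^(m-1) |x|^m; the second cancels |x|^m. *)
pose c1 (t : R) (y : nat -> R) : R := (0 < enorm m y)%R%:R *
   ((enorm m y < t)%R%:R * (m%:R * t ^- m.+1)) * enorm m y ^+ m.
have c1_ge0 t y : 0 <= c1 t y.
  rewrite /c1 mulr_ge0 ?exprn_ge0 ?enorm_ge0// mulr_ge0//.
  case: ltP => yt; rewrite ?mul0r// mul1r mulr_ge0// invr_ge0 exprn_ge0//.
  by rewrite ltW// (le_lt_trans (enorm_ge0 m y)).
have p0 (t : R) : 0 <= (0 < t)%R%:R * (m%:R * t ^+ n).
  by case: ltP => t0; rewrite ?mul0r// mul1r mulr_ge0// exprn_ge0// ltW.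
pose c2 (t : R) (x : nat -> R) : R := (0 < enorm m x < 1)%R%:R *
   (((0 < t)%R%:R * (m%:R * t ^+ n)) * enorm m x ^+ m).
have c2_ge0 t y : 0 <= c2 t y.
  by apply: mulr_ge0 => //; apply: mulr_ge0; rewrite ?exprn_ge0 ?enorm_ge0.
pose c3 (t : R) (x : nat -> R) : R := (0 < enorm m x < 1)%R%:R *
   ((0 < t)%R%:R * (m%:R * t ^+ n)).
have c3_ge0 t y : 0 <= c3 t y.
  by rewrite /c3 mulr_ge0.
have pm1 : pmeasurable (fun (t : R) y => (c1 t y)%:E * K y)%E.
  move=> d T p e mp me; apply: emeasurable_funM; last exact: mK.
  by have mn := men _ _ _ me; rewrite /c1; mfun.
have pm2 : pmeasurable (fun (t : R) x => (c2 t x)%:E * K (fun i => t * x i)%R)%E.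
  move=> d T p e mp me; apply: emeasurable_funM.
    by have mn := men _ _ _ me; rewrite /c2; mfun.
  by apply: mK => i; mfun.
have pm3 : pmeasurable
    (fun (t : R) x => (c3 t x)%:E * K (fun i => t * x i / enorm m x)%R)%E.
  move=> d T p e mp me; have mn := men _ _ _ me; apply: emeasurable_funM.
    by rewrite /c3; mfun.
  by apply: mK => i; mfun.
rewrite iint_neq0//.
transitivity (iint m (fun y => \int[leb]_t ((c1 t y)%:E * K y)))%E.
  apply: eq_iint => y; rewrite -/m.
  have [y0|y0] := ltP 0 (enorm m y); last first.
    rewrite mul0e integral0_eq// => t _.
    by rewrite /c1 ltNge y0/= !mul0r mul0e.
  under eq_integral do rewrite muleC.
  rewrite mul1e ge0_integralZl//; last 2 first.
    have : measurable_fun setT (fun t => (c1 t y)%:E) by rewrite /c1; mfun.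
    exact.
    by move=> t _; rewrite lee_fin.
  rewrite [X in (_ * X)%E](_ : _ = 1%E) ?mule1//.
  rewrite /c1 y0.
  under eq_integral do rewrite mul1r mulrC EFinM.
  rewrite ge0_integralZl//; last 3 first.
  - have : measurable_fun setT (fun t => ((enorm m y < t)%R%:R * (m%:R * t ^- m.+1))%:E) by mfun.
    exact.
  - move=> t _; rewrite lee_fin.
    case: ltP => yt; rewrite ?mul0r// mul1r mulr_ge0// invr_ge0 exprn_ge0//.
    by rewrite ltW// (le_lt_trans (enorm_ge0 m y)).
  - by rewrite lee_fin exprn_ge0// ltW.
  by rewrite integral_invn// -EFinM divff// expf_neq0// gt_eqF.
rewrite -iint_tonelli//; last by move=> t v; rewrite mule_ge0// lee_fin.
transitivity (\int[leb]_t iint m (fun x => (c2 t x)%:E * K (fun i => t * x i)%R))%E.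
  apply: eq_integral => t _.
  have [t0|t0] := ltP 0 t; last first.
    apply: eq_iint => x; rewrite /c2 /c1 [0 < t]ltNge t0/= !(mul0r, mulr0, mul0e).
    by rewrite [enorm _ _ < t]ltNge (le_trans t0 (enorm_ge0 _ _))/= !(mul0r, mulr0, mul0e).
  have vm1 := pmeasurable_vmeasurable t pm1.
  have := iint_scale m t0 (fun v => _) vm1.
  move=> /(_ (fun v => mule_ge0 _ (K0 v))) Hs.
  have {}Hs := Hs (fun v => c1_ge0 t v).
  transitivity ((t ^+ m)%:E * iint m (fun v =>
      (c1 t (fun i => t * v i)%R)%:E * K (fun i => t * v i)%R))%E.
    by rewrite Hs muleA -EFinM divff ?mul1e// expf_neq0// gt_eqF.
  rewrite -iintZ; last 3 first.
  - by rewrite exprn_ge0// ltW.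
  - by move=> v; rewrite mule_ge0// lee_fin.
  - exact: (vmeasurable_scale t vm1).
  apply: eq_iint => x; rewrite muleA -EFinM; congr (_%:E * _)%E.
  rewrite /c1 /c2 enorm_scale ?(ltW t0)// pmulr_rgt0// t0.
  rewrite (_ : (t * enorm m x < t) = (enorm m x < 1)); last by rewrite -[X in _ < X]mulr1 ltr_pM2l.
  case: (0 < _) => /=; last by rewrite !(mul0r, mulr0).
  case: (_ < 1) => /=; last by rewrite !(mul0r, mulr0).
  rewrite /m !mul1r exprMn !exprS; field; by rewrite ?expf_neq0 ?gt_eqF.
rewrite iint_tonelli//; last by move=> t v; rewrite mule_ge0// lee_fin.
transitivity (iint m (fun x => \int[leb]_t
    ((c3 t x)%:E * K (fun i => t * x i / enorm m x)%R)))%E.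
  apply: eq_iint => x.
  have [x0|x0] := ltP 0 (enorm m x); last first.
    by apply: eq_integral => t _; rewrite /c2 /c3 ltNge x0/= !(mul0r, mul0e).
  have vi0 : 0 < (enorm m x)^-1 by rewrite invr_gt0.
  have m2 : measurable_fun setT (fun t => (c2 t x)%:E * K (fun i => t * x i)%R)%E.
    by apply: (pm2 _ _ id (fun=> x)) => // i; exact: measurable_cst.
  have := integral_scale vi0 m2; rewrite invrK => Hs.
  have {}Hs := Hs (fun t => mule_ge0 (c2_ge0 t x : (0 <= (c2 t x)%:E)%E) (K0 _)).
  transitivity ((enorm m x)^-1%:E * ((enorm m x)%:E *
      \int[leb]_t ((c2 t x)%:E * K (fun i => t * x i)%R)))%E.
    by rewrite muleA -EFinM mulVf ?mul1e// gt_eqF.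
  rewrite -Hs -ge0_integralZl//; last 3 first.
  - have : measurable_fun setT (fun t => (c2 ((enorm m x)^-1 * t) x)%:E *
       K (fun i => (enorm m x)^-1 * t * x i)%R)%E.
      by apply: (mfun_comp m2); mfun.
    exact.
  - by move=> t _; rewrite mule_ge0// lee_fin.
  - by rewrite lee_fin ltW.
  apply: eq_integral => t _; rewrite muleA -EFinM.
  congr (_%:E * K _)%E; last first.
    by apply/funext => i; rewrite -mulrA mulrC.
  rewrite /c2 /c3 x0 pmulr_rgt0//.
  case: (_ < 1) => /=; last by rewrite !(mul0r, mulr0).
  case: (0 < t) => /=; last by rewrite !(mul0r, mulr0).
  by rewrite /m !mul1r exprMn exprVn exprS; field; rewrite ?expf_neq0 ?gt_eqF.
rewrite -iint_tonelli//; last by move=> t v; rewrite mule_ge0// lee_fin.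
apply: eq_integral => r _; rewrite -iintZ.
- by apply: eq_iint => x; rewrite muleA -EFinM mulrC.
- exact: p0.
- by move=> v; rewrite mule_ge0// lee_fin.
- move=> d T e me; have mn := men _ _ _ me; apply: emeasurable_funM.
    by mfun.
  by apply: mK => i; mfun.
Qed.

End polar.

(** * Slicing the sphere *)

Section slice.
Variable R : realType.
Notation leb := (@lebesgue_measure R).

(** The exponent m - 2 may be negative, as for m = 1, hence a quotient of natural powers. *)
Lemma powR_half_sub1 m (w : R) : 0 < w ->
  powR (w ^+ 2) ((m%:R - 2) / 2) = w ^+ m / w ^+ 2.
Proof.
move=> w0.
rewrite -[in LHS]powR_mulrn ?(ltW w0)// -powRrM mulrCA mulfV ?mulr1 ?pnatr_eq0//.
by rewrite powRB ?(gt_eqF w0) ?implybT// !powR_mulrn ?ltW.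
Qed.

Lemma ge0_tens (f : R -> R) n v : (forall x, 0 <= f x) -> 0 <= tens f n v.
Proof. by move=> f0; apply: prodr_ge0. Qed.

Lemma sphere_int_iint n r (h : (nat -> R) -> \bar R) :
  ((ball_vol R n)%:E * sphere_int n r h)%E =
  iint n (fun x => if (enorm n x < 1)%R
                   then h (fun i => (r * x i / enorm n x)%R) else 0%E).
Proof.
by rewrite /sphere_int muleA -EFinM mulfV ?mul1e// gt_eqF// ball_vol_gt0.
Qed.

Lemma vmeasurable_cone n r (f : R -> R) : measurable_fun setT f ->
  vmeasurable (fun x => if (enorm n x < 1)%R
                   then (tens f n (fun i => (r * x i / enorm n x)%R))%:E else 0%E).
Proof.
move=> mf d T e me; have mn := measurable_enorm n me.
apply: measurable_fun_ifT; first by mfun.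
  by apply/measurable_EFinP; apply: measurable_tens => // i; mfun.
exact: measurable_cst.
Qed.

Section slice_bound.
Variables (f : R -> R) (h : R -> R -> R) (n : nat) (b r : R).
Hypothesis mf : measurable_fun setT f.
Hypothesis f0 : forall x, 0 <= f x.
Hypothesis mh : forall d (T : measurableType d) (x y : T -> R),
  measurable_fun setT x -> measurable_fun setT y ->
  measurable_fun setT (fun t => h (x t) (y t)).
Hypothesis h0 : forall x y, 0 <= h x y.
Hypothesis b0 : 0 <= b.
Hypothesis r0 : 0 < r.
Let m := n.+1.
Hypothesis Zb : forall u, 0 < u ->
  (ZN f m (Num.sqrt u) <= (b / (sphere_area R m * powR u ((m%:R - 2) / 2)))%:E)%E.

Let phi (x y s : R) : R :=
  (0 < s < 1)%R%:R * (h (r * x / s) (r * y / s) * (b * (r ^+ 2 / r ^+ m) * (s ^+ m / s ^+ 2))).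

Let phi_ge0 x y s : 0 <= phi x y s.
Proof.
rewrite /phi; case: (ltP 0 s) => s0 /=; last by rewrite mul0r.
by rewrite !mulr_ge0// ?invr_ge0 ?exprn_ge0// ltW.
Qed.

(** At |z| = rho the bound on [ZN] carries rho^(2-m). Of the radial density rho^(m-1) this leaves
    only rho d rho, which is s ds by [integral_hypot], where s is the norm of (x, y, z). Everything
    else depends on rho through s alone and is collected in [phi]. *)
Lemma slice_fiber (x y : R) :
  (iint m (fun z => let e := Num.sqrt (x ^+ 2 + y ^+ 2 + enorm m z ^+ 2)%R in
     ((e < 1)%R%:R * (h (r * x / e) (r * y / e) * tens f m (fun i => r * z i / e)))%:E)
   <= \int[leb]_s (((Num.sqrt (x ^+ 2 + y ^+ 2)%R < s)%R%:R * s)%:E * (phi x y s)%:E))%E.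
Proof.
set a := x ^+ 2 + y ^+ 2.
have a0 : 0 <= a by rewrite addr_ge0 ?sqr_ge0.
have mphi : measurable_fun setT (fun s => (phi x y s)%:E).
  by rewrite /phi; mfun; apply: mh; mfun.
rewrite -(integral_hypot a0 mphi); last by move=> s; rewrite lee_fin.
rewrite iint_polar; last 2 first.
- by move=> z /=; rewrite lee_fin !mulr_ge0// ge0_tens.
- move=> d T e me /=; have mn := measurable_enorm m me.
  mfun; first by apply: mh; mfun.
  by apply: measurable_tens => // i; mfun.
apply: le_integral_ge0 => rho _.
  apply: mule_ge0.
    by rewrite lee_fin; case: ltP => t0; rewrite ?mul0r// mul1r mulr_ge0// exprn_ge0// ltW.
  by apply: iint_ge0 => z /=; rewrite -EFinM lee_fin !mulr_ge0// ge0_tens.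
have [rho0|rho0] := ltP 0 rho; last by rewrite !mul0r !mul0e.
rewrite !mul1r.
set s := Num.sqrt (a + rho ^+ 2).
have s0 : 0 < s by rewrite sqrtr_gt0 ltr_wpDl// exprn_gt0.
(* Radius of the sphere carrying the last m coordinates once the whole vector is normalized to norm
   [r]. *)
pose w := r * rho / s.
have w0 : 0 < w by rewrite /w divr_gt0// mulr_gt0.
pose k := (s < 1)%R%:R * h (r * x / s) (r * y / s).
have k0 : 0 <= k by rewrite mulr_ge0.
have vm0 := ball_vol_gt0 R m.
apply: (@le_trans _ _ ((m%:R * rho ^+ n)%:E *
    (k%:E * ((ball_vol R m)%:E * ZN f m (Num.sqrt (w ^+ 2))))))%E.
  apply: lee_pmul => //.
  - by rewrite lee_fin mulr_ge0// exprn_ge0// ltW.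
  - by apply: iint_ge0 => z /=; rewrite -EFinM lee_fin !mulr_ge0// ge0_tens.
  rewrite /ZN sphere_int_iint -iintZ//; last 2 first.
  - by move=> v; case: ifP => // _; rewrite lee_fin ge0_tens.
  - exact: vmeasurable_cone.
  apply: le_iint => z.
    by rewrite /= -EFinM lee_fin !mulr_ge0// ge0_tens.
  have [z0|z0] := ltP 0 (enorm m z); last first.
    rewrite mul0e mule_ge0 ?lee_fin//; case: ifP => // _.
    by rewrite lee_fin ge0_tens.
  case: (ltP (enorm m z) 1) => z1 /=; last by rewrite mul0e mule0.
  have -> : enorm m (fun i => rho * z i / enorm m z) = rho.
    under [fun i => _]eq_fun do rewrite mulrAC.
    by rewrite enorm_scale ?divr_ge0 ?ltW// mulfVK// gt_eqF.
  rewrite mul1e -/s -EFinM lee_fin /k mulrA.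
  rewrite sqrtr_sqr gtr0_norm// ler_wpM2l// le_eqVlt; apply/orP; left; apply/eqP.
  by congr tens; apply/funext => i; rewrite /w; field; rewrite !gt_eqF.
apply: (@le_trans _ _ ((m%:R * rho ^+ n)%:E *
    (k%:E * ((ball_vol R m)%:E *
     (b / (sphere_area R m * powR (w ^+ 2) ((m%:R - 2) / 2)))%:E))))%E.
  apply: lee_wpmul2l; first by rewrite lee_fin mulr_ge0// exprn_ge0// ltW.
  apply: lee_wpmul2l; first by rewrite lee_fin.
  apply: lee_wpmul2l; first by rewrite lee_fin ltW.
  by apply: Zb; rewrite exprn_gt0.
rewrite -!EFinM lee_fin powR_half_sub1// /sphere_area /k /phi s0/=.
set q := (s < 1)%R%:R; set H := h _ _.
rewrite le_eqVlt; apply/orP; left; apply/eqP.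
rewrite /w /m !exprMn !exprVn !exprS; field.
by rewrite ?expf_neq0 ?gt_eqF// ?pnatr_eq0//.
Qed.

(** The norm s of the whole vector is integrated last. Rescaling (x, y) by r / s contributes (s /
    r)^2, and the total power s^(m+1) integrates to 1 / (m+2) over the unit interval; divided by the
    volume of the ball this is the reciprocal of [sphere_area R m.+2]. *)
Lemma sphere_int_slice :
  (sphere_int m.+2 r (fun v => (h (v 0%N) (v 1%N) * tens f m (fun i => v i.+2))%:E)
   <= (b / (sphere_area R m.+2 * r ^+ m))%:E * \int[leb]_x \int[leb]_y (h x y)%:E)%E.
Proof.
have V0 := ball_vol_gt0 R m.+2.
pose H v : \bar R := (h (v 0%N) (v 1%N))%:E.
have H0 v : (0 <= H v)%E by rewrite lee_fin.
have vH : vmeasurable H.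
  by move=> d T e me; apply/measurable_EFinP; apply: mh; exact: me.
rewrite -[X in (_ <= _ * X)%E]/(iint 2 H).
suff Hs : (iint m.+2 (fun x => if (enorm m.+2 x < 1)%R
      then (h (r * x 0%N / enorm m.+2 x) (r * x 1%N / enorm m.+2 x)
            * tens f m (fun i => r * x i.+2 / enorm m.+2 x))%:E else 0%E)
    <= (b / (m.+2%:R * r ^+ m))%:E * iint 2 H)%E.
  rewrite /sphere_int; apply: (le_trans (lee_wpmul2l _ Hs)).
    by rewrite lee_fin invr_ge0 ltW.
  rewrite muleA -EFinM le_eqVlt; apply/orP; left; apply/eqP; congr (_%:E * _)%E.
  by rewrite /sphere_area; field; rewrite ?expf_neq0 ?gt_eqF.
pose G (s : R) (v : nat -> R) : \bar R :=
  (((Num.sqrt (v 0%N ^+ 2 + v 1%N ^+ 2) < s)%R%:R * s)%:E * (phi (v 0%N) (v 1%N) s)%:E)%E.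
have G0 s v : (0 <= G s v)%E.
  rewrite /G; apply: mule_ge0; rewrite lee_fin//.
  case: ltP => sv; rewrite ?mul0r// mul1r ltW//.
  by rewrite (le_lt_trans _ sv)// sqrtr_ge0.
have pG : pmeasurable G.
  move=> d T p e mp me; apply: emeasurable_funM; first by mfun.
  by rewrite /phi; mfun; apply: mh; mfun.
apply: (@le_trans _ _ (\int[leb]_s iint 2 (G s))%E).
  rewrite [leRHS](iint_tonelli 2 G0 pG).
  set F := (F in iint m.+2 F).
  change (\int[leb]_x \int[leb]_y iint m (fun z => F (scons x (scons y z))) <=
    \int[leb]_x \int[leb]_y \int[leb]_s G s (scons x (scons y (fun=> 0%R))))%E.
  apply: le_integral_ge0 => x _; last apply: le_integral_ge0 => y _.
  - apply: integral_ge0 => y _; apply: iint_ge0 => z; rewrite /F.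
    by case: ifP => // _; rewrite lee_fin mulr_ge0// ge0_tens.
  - apply: iint_ge0 => z; rewrite /F.
    by case: ifP => // _; rewrite lee_fin mulr_ge0// ge0_tens.
  apply: le_trans (slice_fiber x y); apply: le_iint => z; rewrite /F.
    by case: ifP => // _; rewrite lee_fin mulr_ge0// ge0_tens.
  rewrite !enorm_scons sqr_sqrtr ?addr_ge0 ?sqr_ge0// addrA/=.
  by case: ltP => _; rewrite ?mul1r// ?mul0r.
pose c (s : R) : R := (0 < s < 1)%R%:R * (s * (b * (r ^+ 2 / r ^+ m) * (s ^+ m / s ^+ 2))).
have c0 s : 0 <= c s.
  rewrite /c; case: (ltP 0 s) => s0 /=; last by rewrite mul0r.
  by rewrite !mulr_ge0// ?invr_ge0 ?exprn_ge0// ltW.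
(* Closed at 1 to match the half-open intervals of [integral_expn]. *)
pose c' (s : R) : R := (0 < s <= 1)%R%:R * (m.+2%:R * s ^+ m.+1).
have c'0 s : 0 <= c' s.
  rewrite /c'; case: (ltP 0 s) => s0 /=; last by rewrite mul0r.
  by do 2 (apply: mulr_ge0 => //); apply: exprn_ge0; exact: ltW.
have bm0 : 0 <= b / (m.+2%:R * r ^+ m).
  by rewrite divr_ge0// mulr_ge0// exprn_ge0// ltW.
apply: (@le_trans _ _ (\int[leb]_s ((b / (m.+2%:R * r ^+ m) * c' s)%:E * iint 2 H))%E).
  apply: le_integral_ge0 => s _; first exact: iint_ge0.
  have [s0|s0] := ltP 0 s; last first.
    apply: (@le_trans _ _ (iint 2 (fun=> 0%E : \bar R))).
      by apply: le_iint => // v; rewrite /G /phi [0 < s]ltNge s0/= mul0r mule0.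
    have -> : iint 2 (fun=> 0%E : \bar R) = 0%E :> \bar R.
      by rewrite /= integral0_eq// => x _; rewrite integral0_eq.
    by apply: mule_ge0; [rewrite lee_fin mulr_ge0|exact: iint_ge0].
  have rs0 : 0 < r / s by rewrite divr_gt0.
  (* The constraint |(x, y)| < s is dropped here: [h] gets integrated over the plane instead of the
     disc of radius [r]. *)
  apply: (@le_trans _ _ (iint 2 (fun v => (c s)%:E * H (fun i => r / s * v i)%R)%E)).
    apply: le_iint => // v; rewrite /G /H /phi /c -!EFinM lee_fin.
    rewrite ![r * _ / s]mulrAC.
    set hh := h _ _; have hh0 : 0 <= hh by exact: h0.
    case: (ltP _ s) => _; last first.
      by rewrite !mul0r mulr_ge0//; exact: (c0 s).
    rewrite mul1r le_eqVlt; apply/orP; left; apply/eqP; ring.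
  rewrite iintZ//; last exact: vmeasurable_scale.
  rewrite iint_scale// muleA -EFinM; apply: lee_wpmul2r; first exact: iint_ge0.
  rewrite lee_fin /c /c' s0/=.
  apply: (@le_trans _ _ ((s <= 1)%R%:R * (s * (b * (r ^+ 2 / r ^+ m) * (s ^+ m / s ^+ 2))) / (r / s) ^+ 2)).
    rewrite ler_wpM2r ?invr_ge0 ?exprn_ge0 ?(ltW rs0)// ler_wpM2r//.
      by rewrite !mulr_ge0// ?invr_ge0 ?exprn_ge0// ltW.
    by rewrite ler_nat; case: (ltP s 1) => // /ltW ->.
  set q := (s <= 1)%R%:R.
  rewrite le_eqVlt; apply/orP; left; apply/eqP.
  by rewrite [s ^+ m.+1]exprS; field; rewrite ?expf_neq0 ?gt_eqF.
have mc' : measurable_fun setT (fun s : R => (c' s)%:E) by rewrite /c'; mfun.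
rewrite ge0_integralZr//; last 3 first.
- have : measurable_fun setT (fun s => (b / (m.+2%:R * r ^+ m) * c' s)%:E) by rewrite /c'; mfun.
  exact.
- by move=> s _; rewrite lee_fin mulr_ge0.
- exact: iint_ge0.
apply: lee_wpmul2r; first exact: iint_ge0.
under eq_integral do rewrite EFinM.
rewrite ge0_integralZl//; last by move=> s _; rewrite lee_fin.
by rewrite integral_expn// expr1n expr0n/= subr0 mule1.
Qed.

End slice_bound.
End slice.

(** * Pointwise bounds *)

Section pointwise.
Variable R : realType.

Lemma powR_add_le (p a b : R) : 1 <= p -> 0 <= a -> 0 <= b ->
  powR (a + b) p <= powR 2 (p - 1) * (powR a p + powR b p).
Proof.
move=> p1 a0 b0.
have H : powR (2^-1 * (2 * a) + 2^-1 * (2 * b)) p <=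
    2^-1 * powR (2 * a) p + 2^-1 * powR (2 * b) p.
  rewrite {2 4}(_ : 2^-1 = 1 - 2^-1 :> R); last by rewrite {2}(splitr 1) div1r addrK.
  by apply: (convex_powR p1 (Itv01 _ _)) => //=;
    rewrite ?inE/= ?in_itv/= ?mulr_ge0// ?invr_ge0// invf_le1 ?ler1n.
move: H; rewrite !mulrA mulVf// !mul1r => /le_trans; apply.
rewrite !powRM// !mulrA -powR_inv1// -powRD ?pnatr_eq0 ?implybT//.
by rewrite (addrC _ p) -mulrDr.
Qed.

(** Two rounds of the two-term inequality, each costing 2^beta. *)
Lemma powR_add4_le (beta a b c d : R) : 0 <= beta ->
  0 <= a -> 0 <= b -> 0 <= c -> 0 <= d ->
  powR (a + b + (c + d)) (1 + beta) <= powR 2 (2 * beta) *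
    (powR a (1 + beta) + powR b (1 + beta) + (powR c (1 + beta) + powR d (1 + beta))).
Proof.
move=> be0 a0 b0 c0 d0.
have p1 : 1 <= 1 + beta by rewrite lerDl.
have pE : 1 + beta - 1 = beta by rewrite addrAC subrr add0r.
apply: (le_trans (powR_add_le p1 (addr_ge0 a0 b0) (addr_ge0 c0 d0))).
have -> : powR 2 (2 * beta) = powR 2 beta * powR 2 beta :> R.
  by rewrite (_ : 2 * beta = beta + beta); [rewrite powRD ?pnatr_eq0 ?implybT|ring].
rewrite pE -mulrA ler_wpM2l ?powR_ge0// mulrDr lerD//.
  by have := powR_add_le p1 a0 b0; rewrite pE.
by have := powR_add_le p1 c0 d0; rewrite pE.
Qed.

Lemma psiC (beta x y : R) : 0 < x -> 0 < y -> psi beta x y = psi beta y x.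
Proof.
move=> x0 y0; rewrite /psi distrC; congr (_ * powR _ _).
by rewrite !ln_div ?posrE// distrC.
Qed.

Lemma psi_le (beta x y S : R) : 0 < beta -> 0 < y -> y <= x -> ln x - ln y <= S ->
  psi beta x y <= x * powR S (1 + beta).
Proof.
move=> be0 y0 yx xyS.
have x0 : 0 < x by exact: lt_le_trans yx.
have lxy : 0 <= ln x - ln y by rewrite subr_ge0 ler_ln ?posrE.
rewrite /psi ln_div ?posrE// (ger0_norm lxy).
apply: ler_pM => //; rewrite ?powR_ge0//.
  by rewrite ger0_norm ?subr_ge0// gerBl ltW.
apply: ge0_ler_powR => //; first by rewrite addr_ge0// ltW.
by rewrite nnegrE; exact: le_trans xyS.
Qed.

(** The coordinates fixed by the rotation give both densities the same factor [t], which cancels in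
    the logarithm. There the larger density is bounded above through [Cf] and the smaller one below
    through the values of [Phi]. Adding the bounds of the two cases keeps the right-hand side free
    of indicators. *)
Lemma psi_tens_le (beta Cf t a b c d A B C D : R) : 0 < beta -> 0 <= Cf -> 0 < t ->
  0 < a -> 0 < b -> 0 < c -> 0 < d ->
  0 <= A -> 0 <= B -> 0 <= C -> 0 <= D ->
  (ln a <= Cf -> ln b <= Cf -> ln c <= Cf -> ln d <= Cf ->
  - A <= ln a -> - B <= ln b -> - C <= ln c -> - D <= ln d ->
  psi beta (a * b * t) (c * d * t) <=
   powR 2 (2 * beta) * (a * b * (2 * powR Cf (1 + beta) + (powR C (1 + beta) + powR D (1 + beta))) +
     c * d * (2 * powR Cf (1 + beta) + (powR A (1 + beta) + powR B (1 + beta)))) * t).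
Proof.
move=> be0 Cf0 t0.
have half a' b' c' d' C' D' : 0 < a' -> 0 < b' -> 0 < c' -> 0 < d' ->
    0 <= C' -> 0 <= D' -> ln a' <= Cf -> ln b' <= Cf -> - C' <= ln c' -> - D' <= ln d' ->
    c' * d' <= a' * b' ->
    psi beta (a' * b' * t) (c' * d' * t) <= powR 2 (2 * beta) *
      (a' * b' * (2 * powR Cf (1 + beta) + (powR C' (1 + beta) + powR D' (1 + beta)))) * t.
  move=> a0 b0 c0 d0 C0 D0 la lb lc ld cdab.
  apply: (le_trans (@psi_le _ _ _ (Cf + Cf + (C' + D')) be0 _ _ _)).
  - by rewrite !mulr_gt0.
  - by rewrite ler_pM2r.
  - by rewrite !lnM ?posrE ?mulr_gt0//; lra.
  have := powR_add4_le (ltW be0) Cf0 Cf0 C0 D0.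
  rewrite (_ : powR Cf (1 + beta) + powR Cf (1 + beta) = 2 * powR Cf (1 + beta)); last by ring.
  move=> H.
  have abt : 0 <= a' * b' * t by rewrite !mulr_ge0// ltW.
  apply: (le_trans (ler_wpM2l abt H)).
  by rewrite le_eqVlt; apply/orP; left; apply/eqP; ring.
move=> a0 b0 c0 d0 A0 B0 C0 D0 la lb lc ld lA lB lC lD.
have X0 (x y u v : R) : 0 < x -> 0 < y ->
    0 <= x * y * (2 * powR Cf (1 + beta) + (powR u (1 + beta) + powR v (1 + beta))).
  by move=> x0 y0; rewrite !(mulr_ge0, addr_ge0, powR_ge0)// ltW.
have [cdab|/ltW abcd] := leP (c * d) (a * b).
  apply: (le_trans (half _ _ _ _ C D _ _ _ _ _ _ _ _ _ _ cdab)) => //.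
  by rewrite ler_wpM2r ?(ltW t0)// ler_wpM2l ?powR_ge0// lerDl X0.
rewrite psiC ?mulr_gt0//.
apply: (le_trans (half _ _ _ _ A B _ _ _ _ _ _ _ _ _ _ abcd)) => //.
by rewrite ler_wpM2r ?(ltW t0)// ler_wpM2l ?powR_ge0// lerDr X0.
Qed.

Lemma ln_le_C_eps (eps x : R) : 0 < eps -> 1 <= x ->
  ln x <= C_eps eps * powR x eps.
Proof.
move=> e0 x1.
have x0 : 0 < x by exact: lt_le_trans x1.
rewrite -ler_pdivrMr ?powR_gt0//.
apply: ub_le_sup; last by exists x.
(* [eps * ln y] is the logarithm of [powR y eps], hence less than [powR y eps]. *)
exists eps^-1 => _ [y [y1 ->]].
have y0 : 0 < y by exact: lt_le_trans y1.
rewrite ler_pdivrMr ?powR_gt0// [eps^-1 * _]mulrC ler_pdivlMr// mulrC.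
by rewrite -ln_powR ltW// ln_sublinear// powR_gt0.
Qed.

Lemma C_eps_gt0 (eps : R) : 0 < eps -> 0 < C_eps eps.
Proof.
move=> e0.
have e1 : 1 <= expR 1 :> R by apply: le_trans (expR_ge1Dx 1); rewrite lerDl.
have := ln_le_C_eps e0 e1; rewrite expRK => H.
have := lt_le_trans ltr01 H.
by rewrite pmulr_lgt0// powR_gt0// expR_gt0.
Qed.

Lemma ln_le_sup (f : R -> R) (eps v : R) : 0 < eps -> (exists M, forall v, f v <= M) ->
  (forall v, 0 < f v) -> ln (f v) <= C_eps eps * powR (sup_f f) eps.
Proof.
move=> e0 [M fM] f0.
have fs : f v <= sup_f f.
  by apply: ub_le_sup; [exists M => _ [w _ <-]; exact: fM|exists v].
have [f1|f1] := leP 1 (f v); last first.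
  apply: (@le_trans _ _ 0); first by rewrite ln_le0// ltW.
  by rewrite mulr_ge0 ?powR_ge0// ltW// C_eps_gt0.
apply: (le_trans (ln_le_C_eps e0 f1)).
rewrite ler_wpM2l ?(ltW (C_eps_gt0 e0))//.
by apply: ge0_ler_powR; rewrite ?nnegrE ?(ltW e0)// ?(le_trans _ fs)// ltW.
Qed.

End pointwise.

(** * Rotations of the plane and periodic integrals *)

Section planar.
Variable R : realType.
Notation leb := (@lebesgue_measure R).

Definition measurable2 (h : R -> R -> \bar R) : Prop :=
  forall d (T : measurableType d) (x y : T -> R),
  measurable_fun setT x -> measurable_fun setT y ->
  measurable_fun setT (fun t => h (x t) (y t)).

Lemma tonelli2 (h : R -> R -> \bar R) : measurable2 h -> (forall x y, (0 <= h x y)%E) ->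
  (\int[leb]_x \int[leb]_y h x y = \int[leb]_y \int[leb]_x h x y)%E.
Proof. by move=> mh h0; apply: tonelli => //; apply: mh; mfun. Qed.

Lemma integral_shear_snd (t : R) (h : R -> R -> \bar R) :
  measurable2 h -> (forall x y, (0 <= h x y)%E) ->
  (\int[leb]_x \int[leb]_y h x (y + t * x)%R = \int[leb]_x \int[leb]_y h x y)%E.
Proof.
move=> mh h0; apply: eq_integral => x _.
by apply: (@integral_shift _ _ (h x)) => //; apply: mh; mfun.
Qed.

Lemma integral_shear_fst (t : R) (h : R -> R -> \bar R) :
  measurable2 h -> (forall x y, (0 <= h x y)%E) ->
  (\int[leb]_x \int[leb]_y h (x + t * y)%R y = \int[leb]_x \int[leb]_y h x y)%E.
Proof.
move=> mh h0; rewrite (tonelli2 mh)// tonelli2//.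
  apply: eq_integral => y _.
  by apply: (@integral_shift _ _ (fun x => h x y)) => //; apply: mh; mfun.
by move=> d T x y mx my; apply: mh; mfun.
Qed.

(* A rotation is a product of three shears, except for the half-turn. *)
Lemma integral_rotation (c s : R) (h : R -> R -> \bar R) : c ^+ 2 + s ^+ 2 = 1 ->
  measurable2 h -> (forall x y, (0 <= h x y)%E) ->
  (\int[leb]_x \int[leb]_y h (x * c + y * s)%R (- x * s + y * c)%R
   = \int[leb]_x \int[leb]_y h x y)%E.
Proof.
move=> cs1 mh h0.
have [c1|c1] := eqVneq (1 + c) 0.
  have cE : c = -1 by lra.
  have sE : s = 0 by apply/eqP; rewrite -sqrf_eq0; apply/eqP; rewrite cE in cs1; lra.
  transitivity (\int[leb]_x \int[leb]_y h (0 - x)%R (0 - y)%R)%E.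
    apply: eq_integral => x _; apply: eq_integral => y _; rewrite cE sE; congr h; ring.
  transitivity (\int[leb]_x \int[leb]_y h (0 - x)%R y)%E.
    apply: eq_integral => x _.
    by apply: (@integral_reflect _ _ (h (0 - x))) => //; apply: mh; mfun.
  have mh' : measurable2 (fun x y => h (0 - x) y).
    by move=> d T x y mx my; apply: mh; mfun.
  rewrite (tonelli2 mh)// tonelli2//; apply: eq_integral => y _.
  by apply: (@integral_reflect _ _ (fun x => h x y)) => //; apply: mh; mfun.
(* The tangent of the half-angle: the rotation is the horizontal shear by [t], then the vertical one
   by [- s], then the horizontal one by [t] again. *)
pose t := s / (1 + c).
have ts : t * s = 1 - c.
  rewrite /t mulrAC -expr2.
  have -> : s ^+ 2 = (1 - c) * (1 + c) by rewrite -subr_sqr expr1n -cs1; ring.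
  by rewrite mulfK.
have tc : t * (1 + c) = s by rewrite mulfVK.
pose g1 x y := h (x + t * y)%R y.
have mg1 : measurable2 g1 by move=> d T x y mx my; apply: mh; mfun.
pose g2 x y := g1 x (y + (- s) * x)%R.
have mg2 : measurable2 g2 by move=> d T x y mx my; apply: mg1; mfun.
rewrite -(integral_shear_fst t mh)// -(integral_shear_snd (- s) mg1)//; last first.
  by move=> x y; exact: h0.
rewrite -(integral_shear_fst t mg2)//; last by move=> x y; exact: h0.
apply: eq_integral => x _; apply: eq_integral => y _; rewrite /g2 /g1.
have e1 : y + - s * (x + t * y) = - x * s + y * c.
  have -> : y + - s * (x + t * y) = - x * s + y * (1 - t * s) by ring.
  by rewrite ts; ring.
rewrite e1; congr h.
have -> : x + t * y + t * (- x * s + y * c) = x * (1 - t * s) + y * (t * (1 + c)) by ring.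
by rewrite ts tc; ring.
Qed.

Section periodic.
Variables (P : R) (q : R -> \bar R).
Hypothesis mq : measurable_fun setT q.
Hypothesis q0 : forall x, (0 <= q x)%E.
Hypothesis qP : forall x, q (x + P) = q x.

Lemma integral_indE (a b : R) (p : R -> \bar R) :
  (\int[leb]_(x in `[a, b[) p x = \int[leb]_x ((a <= x < b)%R%:R%:E * p x))%E.
Proof.
rewrite integral_mkcond; apply: eq_integral => x _.
by rewrite /patch mem_setE/= in_itv/=; case: ifP; rewrite ?mul1e ?mul0e.
Qed.

(** The shifted period [[c, P + c[] is cut at [P] and its right piece moved back by one period.
    Half-open intervals make the pieces tile exactly. *)
Lemma integral_period_shift (c : R) : 0 <= c <= P ->
  (\int[leb]_(x in `[0%R, P]) q (x + c)%R = \int[leb]_(x in `[0%R, P]) q x)%E.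
Proof.
move=> /andP[c0 cP].
have mqc : measurable_fun setT (fun x : R => q (x + c)) by mfun.
have mI (a b : R) (p : R -> \bar R) : measurable_fun setT p ->
    measurable_fun setT (fun x : R => (a <= x < b)%R%:R%:E * p x)%E.
  by move=> mp; apply: emeasurable_funM => //; mfun.
have I0 (a b : R) (p : R -> \bar R) x : (forall x, (0 <= p x)%E) ->
    (0 <= (a <= x < b)%R%:R%:E * p x)%E.
  by move=> p0; rewrite mule_ge0// lee_fin.
rewrite -!integral_itv_bndo_bndc; [|exact: measurable_funTS..].
rewrite !integral_indE.
transitivity (\int[leb]_x ((c <= x < P + c)%R%:R%:E * q x))%E.
  rewrite -[RHS](@integral_shift _ c); [|exact: mI|by move=> x; exact: I0].
  by apply: eq_integral => x _; rewrite lerDr ltrD2r.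
transitivity (\int[leb]_x ((c <= x < P)%R%:R%:E * q x) +
              \int[leb]_x ((P <= x < P + c)%R%:R%:E * q x))%E.
  rewrite -ge0_integralD//; first last.
  - exact: mI.
  - by move=> x _; exact: I0.
  - exact: mI.
  - by move=> x _; exact: I0.
  apply: eq_integral => x _; rewrite -ge0_muleDl ?lee_fin// -EFinD; congr (_%:E * _)%E.
  have [Px|xP] := leP P x; first by rewrite (le_trans cP Px)/= add0r.
  by rewrite (lt_le_trans xP) ?lerDl// !andbT addr0.
rewrite -[X in (_ + X)%E](@integral_shift _ P); [|exact: mI|by move=> x; exact: I0].
rewrite -ge0_integralD//; first last.
- have : measurable_fun setT (fun x : R => (P <= x + P < P + c)%R%:R%:E * q (x + P))%E.
    by apply: emeasurable_funM; mfun.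
  exact.
- by move=> x _; exact: I0.
- exact: mI.
- by move=> x _; exact: I0.
apply: eq_integral => x _; rewrite qP -ge0_muleDl ?lee_fin// -EFinD; congr (_%:E * _)%E.
rewrite lerDr [x + P]addrC ltrD2l.
have [x0|x0] := leP 0 x; last by rewrite (leNgt c) (lt_le_trans x0 c0)/= addr0.
have [cx|xc] := leP c x; first by rewrite addr0.
by rewrite (lt_le_trans xc cP) add0r.
Qed.

Lemma integral_period_reflect (p : R -> \bar R) :
  measurable_fun setT p -> (forall x, (0 <= p x)%E) ->
  (\int[leb]_(x in `[0%R, P]) p (P - x)%R = \int[leb]_(x in `[0%R, P]) p x)%E.
Proof.
move=> mp p0; rewrite integral_mkcond [RHS]integral_mkcond.
have -> : (p \_ `[0, P]) = fun x => ((0 <= x <= P)%R%:R%:E * p x)%E.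
  by apply/funext => x; rewrite /patch mem_setE/= in_itv/=; case: ifP; rewrite ?mul1e ?mul0e.
rewrite -[RHS](@integral_reflect _ P).
- apply: eq_integral => x _; rewrite /patch mem_setE/= in_itv/=.
  by rewrite subr_ge0 gerBl andbC; case: ifP; rewrite ?mul1e ?mul0e.
- by apply: emeasurable_funM => //; mfun.
- by move=> x; rewrite mule_ge0// lee_fin.
Qed.

End periodic.
End planar.

(** * Averaging over the angle *)

Lemma iintD (R : realType) n (F G : (nat -> R) -> \bar R) :
  (forall v, (0 <= F v)%E) -> (forall v, (0 <= G v)%E) ->
  vmeasurable F -> vmeasurable G ->
  iint n (fun v => F v + G v)%E = (iint n F + iint n G)%E.
Proof.
elim: n F G => [|n IH] F G F0 G0 mF mG //=.
rewrite -ge0_integralD//.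
- apply: eq_integral => x _; rewrite IH//;
    exact: pmeasurable_vmeasurable (vmeasurable_scons _).
- by move=> x _; exact: iint_ge0.
- exact: measurable_iint_scons.
- by move=> x _; exact: iint_ge0.
- exact: measurable_iint_scons.
Qed.

(** Here [Q] stands for the moment of the first rotated coordinate, the shift by pi / 2 for that of
    the second, and the reflection for the inverse rotation. All four copies of [Q] have the same
    integral over a period. *)
Lemma integral_periodic_shifts (R : realType) (k : R) (Q : R -> \bar R) :
  let leb := @lebesgue_measure R in
  let J theta := (k%:E + (Q theta + Q (theta + pi / 2)%R))%E in
  0 <= k -> measurable_fun setT Q -> (forall x, (0 <= Q x)%E) ->
  (forall x, Q (x + 2 * pi) = Q x) ->
  (\int[leb]_(theta in `[0%R, (2 * pi)%R]) (J theta + J (2 * pi - theta)%R)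
   = 2%:E * ((2 * pi * k)%:E + 2%:E * \int[leb]_(theta in `[0%R, (2 * pi)%R]) Q theta))%E.
Proof.
move=> leb J k0 mQ Q0 QP.
have pi0 : 0 < 2 * pi :> R by rewrite mulr_gt0// pi_gt0.
have mshift : measurable_fun setT (fun theta : R => theta + pi / 2) by mfun.
have mrefl : measurable_fun setT (fun theta : R => 2 * pi - theta) by mfun.
have mQ' := mfun_comp mQ mshift.
have mS : measurable_fun setT (fun theta : R => Q theta + Q (theta + pi / 2)%R)%E.
  exact: emeasurable_funD.
have mJ : measurable_fun setT J.
  by apply: emeasurable_funD => //; exact: measurable_cst.
have J0 theta : (0 <= J theta)%E.
  by rewrite /J !adde_ge0 ?Q0// lee_fin.
have mJr := mfun_comp mJ mrefl.
rewrite ge0_integralD//; [|by apply: measurable_funTS; exact: mJ|by apply: measurable_funTS; exact: mJr].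
rewrite (@integral_period_reflect _ (2 * pi) J mJ J0).
have -> : (\int[leb]_(theta in `[0%R, (2 * pi)%R]) J theta =
    (2 * pi * k)%:E + 2%:E * \int[leb]_(theta in `[0%R, (2 * pi)%R]) Q theta)%E.
  rewrite /J ge0_integralD//; first last.
    by apply: measurable_funTS; exact: mS.
    by move=> theta _; rewrite adde_ge0.
  congr (_ + _)%E.
    rewrite integral_cst//= lebesgue_measure_itv/= lte_fin pi0 -EFinB -EFinM subr0.
    by congr (_%:E); ring.
  rewrite ge0_integralD//; first last.
    by apply: measurable_funTS; exact: mQ'.
    by apply: measurable_funTS; exact: mQ.
  rewrite (@integral_period_shift _ (2 * pi) Q mQ Q0 QP).
  - by rewrite mule_natl mule2n.
  - by have := pi_gt0 R; lra.
by rewrite [RHS]mule_natl mule2n.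
Qed.

Section angular_average.
Variables (R : realType) (f Phi : R -> R) (beta K : R).
Notation leb := (@lebesgue_measure R).
Hypothesis mf : measurable_fun setT f.
Hypothesis f0 : forall v, 0 <= f v.
Hypothesis f1 : (\int[leb]_v (f v)%:E = 1)%E.
Hypothesis mPhi : measurable_fun setT Phi.
Hypothesis K0 : 0 <= K.
Let p := 1 + beta.

(** The second rotated coordinate is the first one at angle theta + pi / 2, so this single function
    of the angle serves both. *)
Definition rotated_moment (theta : R) : \bar R :=
  iint 2 (fun v => (powR (Phi (v 0%N * cos theta + v 1%N * sin theta)) p
                    * (f (v 0%N) * f (v 1%N)))%:E).

(* Up to the factor [2 `^ (2 * beta)] lost to convexity, [weight] and [weight_rot] dominate
   [f x * f y] (resp. its rotation) times the power of the logarithm, on the set where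
   that density is the larger of the two; [K] bounds the power of [ln (f v)]. *)
Definition weight (c s x y : R) : R :=
  f x * f y * (2 * K + (powR (Phi (x * c + y * s)) p + powR (Phi (- x * s + y * c)) p)).

Definition weight_rot (c s x y : R) : R :=
  f (x * c + y * s) * f (- x * s + y * c) * (2 * K + (powR (Phi x) p + powR (Phi y) p)).

Lemma weight_ge0 c s x y : 0 <= weight c s x y.
Proof. by rewrite /weight !(mulr_ge0, addr_ge0, powR_ge0). Qed.

Lemma weight_rot_ge0 c s x y : 0 <= weight_rot c s x y.
Proof. by rewrite /weight_rot !(mulr_ge0, addr_ge0, powR_ge0). Qed.

Lemma measurable_weight d (T : measurableType d) (c s x y : T -> R) :
  measurable_fun setT c -> measurable_fun setT s ->
  measurable_fun setT x -> measurable_fun setT y ->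
  measurable_fun setT (fun t => weight (c t) (s t) (x t) (y t)).
Proof. by move=> mc ms mx my; rewrite /weight; mfun. Qed.

Lemma measurable_weight_rot d (T : measurableType d) (c s x y : T -> R) :
  measurable_fun setT c -> measurable_fun setT s ->
  measurable_fun setT x -> measurable_fun setT y ->
  measurable_fun setT (fun t => weight_rot (c t) (s t) (x t) (y t)).
Proof. by move=> mc ms mx my; rewrite /weight_rot; mfun. Qed.

Let rm_integrand (theta : R) (v : nat -> R) : \bar R :=
  (powR (Phi (v 0%N * cos theta + v 1%N * sin theta)) p * (f (v 0%N) * f (v 1%N)))%:E.

Let rm_integrand_ge0 theta v : (0 <= rm_integrand theta v)%E.
Proof. by rewrite lee_fin !mulr_ge0// powR_ge0. Qed.

Let rm_integrand_measurable : pmeasurable rm_integrand.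
Proof. by move=> d T q e mq me; rewrite /rm_integrand; mfun. Qed.

Lemma rotated_moment_ge0 theta : (0 <= rotated_moment theta)%E.
Proof. exact: (iint_ge0 _ (rm_integrand_ge0 theta)). Qed.

Lemma measurable_rotated_moment : measurable_fun setT rotated_moment.
Proof. exact: (@measurable_iint _ 2 _ _ rm_integrand). Qed.

Lemma cos_period (x : R) : cos (x + 2 * pi) = cos x.
Proof. by rewrite mulr_natl cosD2pi. Qed.

Lemma sin_period (x : R) : sin (x + 2 * pi) = sin x.
Proof. by rewrite mulr_natl sinD2pi. Qed.

Lemma integral_rotated_moment :
  (\int[leb]_(theta in `[0%R, (2 * pi)%R]) rotated_moment theta = M_avg f Phi beta)%E.
Proof.
pose I := `[0, 2 * pi]%classic : set R.
pose J (theta : R) v : \bar R := ((0 <= theta <= 2 * pi)%R%:R%:E * rm_integrand theta v)%E.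
have J0 theta v : (0 <= J theta v)%E by rewrite mule_ge0// lee_fin.
have mJ : pmeasurable J.
  by move=> d T q e mq me; apply: emeasurable_funM; [mfun|exact: rm_integrand_measurable].
have indE (theta : R) (F : R -> \bar R) :
    (F \_ I) theta = ((0 <= theta <= 2 * pi)%R%:R%:E * F theta)%E.
  by rewrite /patch mem_setE/= in_itv/=; case: ifP; rewrite ?mul1e ?mul0e.
rewrite integral_mkcond.
transitivity (\int[leb]_theta iint 2 (J theta))%E.
  apply: eq_integral => theta _; rewrite indE iintZ//.
  exact: pmeasurable_vmeasurable rm_integrand_measurable.
rewrite [LHS](iint_tonelli 2 J0 mJ); apply: (@eq_iint _ 2
  (fun v => \int[leb]_theta J theta v)%E
  (fun v => (\int[leb]_(theta in `[0%R, (2 * pi)%R]%classic)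
         (powR (Phi (v 0%N * cos theta + v 1%N * sin theta)) (1 + beta))%:E)
      * (f (v 0%N) * f (v 1%N))%:E)%E) => v.
rewrite -ge0_integralZr//; last 3 first.
- apply: measurable_funTS.
  have : measurable_fun setT (fun theta => (powR (Phi (v 0%N * cos theta + v 1%N * sin theta)) (1 + beta))%:E) by mfun.
  exact.
- by move=> theta _; rewrite lee_fin powR_ge0.
- by rewrite lee_fin mulr_ge0.
by rewrite [RHS]integral_mkcond; apply: eq_integral => theta _; rewrite indE.
Qed.

Lemma integral_product_density : iint 2 (fun v => (f (v 0%N) * f (v 1%N))%:E) = 1%E.
Proof.
rewrite /= -[RHS]f1; apply: eq_integral => x _.
under eq_integral do rewrite EFinM.
rewrite ge0_integralZl ?f1 ?mule1//.
- by apply/measurable_EFinP; exact: mf.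
- by move=> y _; rewrite lee_fin.
- by rewrite lee_fin.
Qed.

Lemma integral_weight theta :
  (\int[leb]_x \int[leb]_y (weight (cos theta) (sin theta) x y)%:E =
   (2 * K)%:E + (rotated_moment theta + rotated_moment (theta + pi / 2)%R))%E.
Proof.
have vm t := pmeasurable_vmeasurable t rm_integrand_measurable.
have vff : vmeasurable (fun v => (f (v 0%N) * f (v 1%N))%:E).
  by move=> d T e me; mfun.
have vff2 : vmeasurable (fun v => (2 * K)%:E * (f (v 0%N) * f (v 1%N))%:E)%E.
  by move=> d T e me; apply: measurable_funeM; exact: vff.
have ff0 v : (0 <= (f (v 0%N) * f (v 1%N))%:E)%E by rewrite lee_fin mulr_ge0.
have k0 : 0 <= 2 * K by rewrite mulr_ge0.
rewrite -[X in (X + _)%E]mule1 -integral_product_density.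
rewrite -iintZ//.
rewrite -[rotated_moment theta]/(iint 2 (rm_integrand theta)).
rewrite -[rotated_moment (theta + _)]/(iint 2 (rm_integrand (theta + pi / 2))).
rewrite -[X in (_ + X)%E](iintD 2 (rm_integrand_ge0 _) (rm_integrand_ge0 _) (vm _) (vm _)).
have s0 v : (0 <= rm_integrand theta v + rm_integrand (theta + pi / 2) v)%E.
  by rewrite adde_ge0.
have vs : vmeasurable (fun v => rm_integrand theta v + rm_integrand (theta + pi / 2) v)%E.
  by move=> d T e me; apply: emeasurable_funD; exact: vm.
have ff20 v : (0 <= (2 * K)%:E * (f (v 0%N) * f (v 1%N))%:E)%E by rewrite mule_ge0.
rewrite -[RHS](iintD 2 ff20 s0 vff2 vs).
apply: (@eq_iint _ 2 (fun v => (weight (cos theta) (sin theta) (v 0%N) (v 1%N))%:E)) => v.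
rewrite -EFinM -!EFinD; congr (_%:E).
rewrite cosDpihalf sinDpihalf /weight.
have -> : v 0%N * - sin theta + v 1%N * cos theta = - v 0%N * sin theta + v 1%N * cos theta.
  by ring.
set X := powR _ _; set Y := powR _ _; ring.
Qed.

(** [weight_rot] is [weight] for the inverse rotation, evaluated at the rotated point, so rotation
    invariance applies. The inverse angle is taken as [2 * pi - theta] to stay in the domain of
    integration. *)
Lemma integral_weight_rot theta :
  (\int[leb]_x \int[leb]_y (weight_rot (cos theta) (sin theta) x y)%:E =
   \int[leb]_x \int[leb]_y (weight (cos (2 * pi - theta)) (sin (2 * pi - theta)) x y)%:E)%E.
Proof.
have -> : cos (2 * pi - theta) = cos theta.
  by rewrite addrC cos_period cosN.
have -> : sin (2 * pi - theta) = - sin theta.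
  by rewrite addrC sin_period sinN.
apply: etrans (@integral_rotation _ (cos theta) (sin theta)
    (fun x y => (weight (cos theta) (- sin theta) x y)%:E) (cos2Dsin2 theta) _ _).
- apply: eq_integral => x _; apply: eq_integral => y _; congr (_%:E).
  have cs := cos2Dsin2 theta.
  rewrite /weight /weight_rot; set c := cos theta in cs *; set s := sin theta in cs *.
  congr (_ * (_ + (powR (Phi _) _ + powR (Phi _) _))).
    transitivity (x * (c ^+ 2 + s ^+ 2)); first by rewrite cs mulr1.
    ring.
  transitivity (y * (c ^+ 2 + s ^+ 2)); first by rewrite cs mulr1.
  ring.
- move=> d T x y mx my; apply/measurable_EFinP.
  by apply: measurable_weight => //; exact: measurable_cst.
- by move=> x y; rewrite lee_fin weight_ge0.
Qed.

Lemma measurable_integral_weights :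
  measurable_fun setT (fun theta : R =>
     \int[leb]_x \int[leb]_y (weight (cos theta) (sin theta) x y)%:E +
     \int[leb]_x \int[leb]_y (weight_rot (cos theta) (sin theta) x y)%:E)%E.
Proof.
apply: emeasurable_funD.
- apply: (@measurable_iint _ 2 _ _ (fun (theta : R) v =>
    (weight (cos theta) (sin theta) (v 0%N) (v 1%N))%:E)).
    by move=> t v; rewrite lee_fin weight_ge0.
  move=> d T q e mq me; apply/measurable_EFinP.
  by apply: measurable_weight => //; mfun.
- apply: (@measurable_iint _ 2 _ _ (fun (theta : R) v =>
    (weight_rot (cos theta) (sin theta) (v 0%N) (v 1%N))%:E)).
    by move=> t v; rewrite lee_fin weight_rot_ge0.
  move=> d T q e mq me; apply/measurable_EFinP.
  by apply: measurable_weight_rot => //; mfun.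
Qed.

Lemma integral_weights :
  (\int[leb]_(theta in `[0%R, (2 * pi)%R])
     (\int[leb]_x \int[leb]_y (weight (cos theta) (sin theta) x y)%:E +
      \int[leb]_x \int[leb]_y (weight_rot (cos theta) (sin theta) x y)%:E)
   = 2%:E * ((4 * pi * K)%:E + 2%:E * M_avg f Phi beta))%E.
Proof.
have -> : 4 * pi * K = 2 * pi * (2 * K) by ring.
rewrite -integral_rotated_moment -integral_periodic_shifts.
- apply: eq_integral => theta _; congr (_ + _)%E; first exact: integral_weight.
  by apply: etrans (integral_weight_rot theta) _; exact: integral_weight.
- by rewrite mulr_ge0.
- exact: measurable_rotated_moment.
- exact: rotated_moment_ge0.
- by move=> theta; rewrite /rotated_moment cos_period sin_period.
Qed.

End angular_average.

(** * The log-power property *)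

Lemma le_sphere_int (R : realType) n (r : R) (F G : (nat -> R) -> \bar R) :
  (forall v, (0 <= F v)%E) -> (forall v, (F v <= G v)%E) ->
  (sphere_int n r F <= sphere_int n r G)%E.
Proof.
move=> F0 FG; rewrite /sphere_int; apply: lee_wpmul2l.
  by rewrite lee_fin invr_ge0 ltW// ball_vol_gt0.
by apply: le_iint => v; case: ifP.
Qed.

Lemma sphere_int_ge0 (R : realType) n (r : R) (F : (nat -> R) -> \bar R) :
  (forall v, (0 <= F v)%E) -> (0 <= sphere_int n r F)%E.
Proof.
move=> F0; apply: mule_ge0; first by rewrite lee_fin invr_ge0 ltW// ball_vol_gt0.
by apply: iint_ge0 => v; case: ifP.
Qed.

Lemma tens_SS (R : realType) (f : R -> R) n v :
  tens f n.+2 v = f (v 0%N) * f (v 1%N) * tens f n (fun i => v i.+2).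
Proof. by rewrite /tens !big_ord_recl/= mulrA. Qed.

Section fixed_angle.
Variables (R : realType) (f Phi : R -> R) (beta Cf b r Z : R) (n : nat).
Notation leb := (@lebesgue_measure R).
Let m := n.+1.
Hypothesis mf : measurable_fun setT f.
Hypothesis f0 : forall v, 0 < f v.
Hypothesis mPhi : measurable_fun setT Phi.
Hypothesis Phi0 : forall v, 0 <= Phi v.
Hypothesis lnf_le : forall v, ln (f v) <= Cf.
Hypothesis lnf_ge : forall v, - Phi v <= ln (f v).
Hypothesis Cf0 : 0 <= Cf.
Hypothesis beta0 : 0 < beta.
Hypothesis b0 : 0 <= b.
Hypothesis r0 : 0 < r.
Hypothesis Z0 : 0 < Z.
Hypothesis Zb : forall u, 0 < u ->
  (ZN f m (Num.sqrt u) <= (b / (sphere_area R m * powR u ((m%:R - 2) / 2)))%:E)%E.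
Let K := powR Cf (1 + beta).

Lemma sphere_int_psi_le theta :
  (sphere_int m.+2 r (fun v => (psi beta (tens f m.+2 v / Z)
                                         (tens f m.+2 (rot12 theta v) / Z))%:E)
   <= (b / (sphere_area R m.+2 * r ^+ m) / Z * powR 2 (2 * beta))%:E *
     (\int[leb]_x \int[leb]_y (weight f Phi beta K (cos theta) (sin theta) x y)%:E +
      \int[leb]_x \int[leb]_y (weight_rot f Phi beta K (cos theta) (sin theta) x y)%:E))%E.
Proof.
have f0' v : 0 <= f v by exact: ltW.
have K0 : 0 <= K by exact: powR_ge0.
set c := cos theta; set s := sin theta.
pose W v : \bar R := (weight f Phi beta K c s (v 0%N) (v 1%N))%:E.
pose W' v : \bar R := (weight_rot f Phi beta K c s (v 0%N) (v 1%N))%:E.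
have W0 v : (0 <= W v)%E by rewrite lee_fin; exact: weight_ge0.
have W'0 v : (0 <= W' v)%E by rewrite lee_fin; exact: weight_rot_ge0.
have vW : vmeasurable W.
  move=> d T e me; apply/measurable_EFinP; apply: measurable_weight => //;
    exact: measurable_cst.
have vW' : vmeasurable W'.
  move=> d T e me; apply/measurable_EFinP; apply: measurable_weight_rot => //;
    exact: measurable_cst.
pose k := Z^-1 * powR 2 (2 * beta).
have k0 : 0 <= k by rewrite mulr_ge0 ?powR_ge0// invr_ge0 ltW.
pose h x y := k * (weight f Phi beta K c s x y + weight_rot f Phi beta K c s x y).
have h0 x y : 0 <= h x y.
  by rewrite mulr_ge0// addr_ge0//; [exact: weight_ge0|exact: weight_rot_ge0].
have mh d (T : measurableType d) (x y : T -> R) :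
    measurable_fun setT x -> measurable_fun setT y ->
    measurable_fun setT (fun t => h (x t) (y t)).
  move=> mx my; apply: mfun_mul; first exact: measurable_cst.
  by apply: mfun_add; [apply: measurable_weight|apply: measurable_weight_rot] => //;
    exact: measurable_cst.
have intE : (\int[leb]_x \int[leb]_y (h x y)%:E = k%:E * (iint 2 W + iint 2 W'))%E.
  rewrite -iintD// -iintZ//.
  - by move=> v; rewrite adde_ge0.
  - by move=> d T e me; apply: emeasurable_funD; [exact: vW|exact: vW'].
rewrite -[X in (_ * (X + _))%E]/(iint 2 W) -[X in (_ * (_ + X))%E]/(iint 2 W').
have -> : ((b / (sphere_area R m.+2 * r ^+ m) / Z * powR 2 (2 * beta))%:E * (iint 2 W + iint 2 W') =
    (b / (sphere_area R m.+2 * r ^+ m))%:E * \int[leb]_x \int[leb]_y (h x y)%:E)%E.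
  by rewrite intE muleA -EFinM /k !mulrA.
apply: le_trans (sphere_int_slice mf f0' mh h0 b0 r0 Zb).
apply: le_sphere_int => v.
  by rewrite lee_fin /psi mulr_ge0// powR_ge0.
(* The normalization [Z] is absorbed into the factor common to both points. *)
have t0 : 0 < tens f m (fun i => v i.+2) / Z.
  by rewrite divr_gt0//; apply: prodr_gt0 => i _; exact: f0.
rewrite lee_fin !tens_SS -!mulrA !(mulrA (f _)) /=.
rewrite -/c -/s.
set x := v 0%N; set y := v 1%N.
rewrite -[tens f m (fun i => rot12 theta v i.+2)]/(tens f m (fun i => v i.+2)).
apply: (le_trans (psi_tens_le beta0 Cf0 t0 (f0 _) (f0 _) (f0 _) (f0 _)
  (Phi0 _) (Phi0 _) (Phi0 _) (Phi0 _) (lnf_le _) (lnf_le _) (lnf_le _) (lnf_le _)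
  (lnf_ge _) (lnf_ge _) (lnf_ge _) (lnf_ge _))).
rewrite le_eqVlt; apply/orP; left; apply/eqP.
rewrite /h /k /weight /weight_rot -/K.
set A := tens _ _ _; set B := powR 2 _.
set X1 := powR _ _; set X2 := powR _ _; set X3 := powR _ _; set X4 := powR _ _.
set f1 := f _; set f2 := f _; set f3 := f _; set f4 := f _.
ring.
Qed.

End fixed_angle.

(** N / (N-2) with N = n + 3 is largest at N = 3. *)
Lemma sqrt_quotient_le3 (R : realType) n :
  Num.sqrt n.+3%:R / Num.sqrt n.+1%:R <= Num.sqrt 3 :> R.
Proof.
rewrite ler_pdivrMr ?sqrtr_gt0// -sqrtrM// ler_wsqrtr// -natrM ler_nat.
by rewrite mulnS -addn3 addnC leq_add2l leq_pmull.
Qed.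

Theorem theorem3p5 (R : realType) (f Phi : R -> R) (g : R -> nat -> R)
  (lam : nat -> R -> R) (beta : R) :
  (* f is a probability density on R with unit second moment *)
  measurable_fun setT f ->
  (forall v, 0 <= f v) ->
  (\int[lebesgue_measure]_v (f v)%:E = 1)%E ->
  (\int[lebesgue_measure]_v (v ^+ 2 * f v)%:E = 1)%E ->
  (* f is g-concentrated with error functions lam *)
  g_concentrated f g lam ->
  (* ||f||_oo < oo *)
  (exists M, forall v, f v <= M) ->
  (* sup_n sup_u |lam_n(u)| < (2 pi)^{-1/2} *)
  (exists c, c < (Num.sqrt (2 * pi))^-1 /\
     forall n u, (1 <= n)%N -> 0 < u -> `|lam n u| <= c) ->
  (* f >= e^{-Phi} with Phi positive *)
  measurable_fun setT Phi ->
  (forall v, 0 < Phi v) ->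
  (forall v, expR (- Phi v) <= f v) ->
  0 < beta ->
  (M_Phi f Phi beta < +oo)%E ->
  (M_avg f Phi beta < +oo)%E ->
  forall eps : R, 0 < eps ->
    log_power_property (condtens f) beta (C_const f Phi g lam beta eps).
Proof.
move=> mf f0 f1 _ [Zform [g0 [[Mg gM] [g00 _]]]] fbd [c [cl lamc]] mPhi Phi0 fPhi
  beta0 MPhi Mavg eps eps0.
have fpos v : 0 < f v by apply: lt_le_trans (fPhi v); exact: expR_gt0.
set s2 := (Num.sqrt (2 * pi))^-1 in g00 cl *.
have s20 : 0 < s2 by rewrite invr_gt0 sqrtr_gt0 mulr_gt0// pi_gt0.
(* [sup] is a true supremum only for nonempty sets that are bounded above; [c], [Mg] and the bound
   on [f] supply this for the three suprema. *)
have lamL n u : (1 <= n)%N -> 0 < u -> `|lam n u| <= sup_lam lam.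
  move=> n1 u0; apply: ub_le_sup; last by exists n, u.
  by exists c => _ [k [w [k1 [w0 ->]]]]; exact: lamc.
have L0 : 0 <= sup_lam lam by apply: le_trans (lamL 1%N 1 _ _).
have Lc : sup_lam lam <= c.
  apply: ge_sup; first by exists `|lam 1%N 1|, 1%N, 1.
  by move=> _ [k [w [k1 [w0 ->]]]]; exact: lamc.
have gG x n : g x n <= sup_g g.
  by apply: ub_le_sup; [exists Mg => _ [y [k ->]]; exact: gM|exists x, n].
set D := s2 - sup_lam lam.
have D0 : 0 < D by rewrite subr_gt0 (le_lt_trans Lc).
set B := sup_g g + sup_lam lam.
(* The supremum of [g] is at least its value [s2] at argument 0. *)
have B0 : 0 < B by rewrite ltr_pwDl// (lt_le_trans s20)// -(g00 0%N).
set Cf := C_eps eps * powR (sup_f f) eps.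
have lnf v : ln (f v) <= Cf by exact: ln_le_sup.
have supf0 : 0 < sup_f f.
  have [M fM] := fbd; apply: (lt_le_trans (fpos 0)).
  by apply: ub_le_sup; [exists M => _ [w _ <-]; exact: fM|exists 0].
have Cf0 : 0 < Cf by rewrite mulr_gt0 ?powR_gt0// C_eps_gt0.
have lnPhi v : - Phi v <= ln (f v).
  by rewrite -[X in X <= _]expRK ler_ln ?posrE ?expR_gt0.
set K := powR Cf (1 + beta).
have K0 : 0 < K by exact: powR_gt0.
have MP0 : (0 <= M_Phi f Phi beta)%E.
  by apply: integral_ge0 => v _; rewrite lee_fin mulr_ge0// powR_ge0.
have MA0 : (0 <= M_avg f Phi beta)%E.
  apply: integral_ge0 => v1 _; apply: integral_ge0 => v2 _.
  apply: mule_ge0; last by rewrite lee_fin mulr_ge0.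
  by apply: integral_ge0 => t _; rewrite lee_fin powR_ge0.
have MAE : M_avg f Phi beta = (fine (M_avg f Phi beta))%:E.
  by rewrite fineK// ge0_fin_numE.
set MA := fine (M_avg f Phi beta) in MAE *.
have MA0' : 0 <= MA by exact: fine_ge0.
set MP := fine (M_Phi f Phi beta).
have MP0' : 0 <= MP by exact: fine_ge0.
pose base := powR 2 (1 + 2 * beta) * Num.sqrt 3 * (B / D) * (2 * K + MP + MA).
have base0 : 0 < base.
  apply: mulr_gt0; first by rewrite !mulr_gt0 ?powR_gt0 ?sqrtr_gt0 ?invr_gt0.
  by rewrite -addrA ltr_pwDl ?mulr_gt0// addr_ge0.
have CE : C_const f Phi g lam beta eps = powR base (1 + beta)^-1 by [].
split=> //; split; first by rewrite CE powR_gt0.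
(* N = n + 3, so the remaining dimension m = N - 2 is at least 1, as [Zform] demands. *)
case=> [//|[//|[//|n]]] _.
rewrite CE -powRrM mulVf ?powRr1 ?(ltW base0)//; last first.
  by rewrite gt_eqF// addr_gt0.
pose m := n.+1; pose r : R := Num.sqrt m.+2%:R.
have r0 : 0 < r by rewrite sqrtr_gt0.
have rm0 : 0 < r ^+ m by exact: exprn_gt0.
have r2 : r ^+ 2 = m.+2%:R by rewrite sqr_sqrtr.
have area0 k : 0 < sphere_area R k.+1 by rewrite mulr_gt0// ball_vol_gt0.
have am0 : 0 < sphere_area R m := area0 n.
have aN0 : 0 < sphere_area R m.+2 := area0 m.+1.
have sm0 : 0 < Num.sqrt m%:R :> R by rewrite sqrtr_gt0.
pose b := 2 / Num.sqrt m%:R * B.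
have b0 : 0 <= b by rewrite mulr_ge0 ?(ltW B0)// divr_ge0.
have Zb u : 0 < u ->
  (ZN f m (Num.sqrt u) <= (b / (sphere_area R m * powR u ((m%:R - 2) / 2)))%:E)%E.
  move=> u0; rewrite Zform// lee_fin.
  have pu0 := powR_gt0 ((m%:R - 2) / 2) u0.
  have -> : b / (sphere_area R m * powR u ((m%:R - 2) / 2)) =
      2 / (Num.sqrt m%:R * sphere_area R m * powR u ((m%:R - 2) / 2)) * B.
    by rewrite /b; field; rewrite (gt_eqF am0) (gt_eqF sm0) (gt_eqF pu0).
  apply: ler_wpM2l.
    by rewrite divr_ge0// ltW//; apply: mulr_gt0 => //; apply: mulr_gt0.
  by apply: lerD; [exact: gG|apply: le_trans (ler_norm _) _; exact: lamL].
pose Z := fine (ZN f m.+2 r).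
(* At u = N the argument of [g] is 0, so its value is exactly [s2]. *)
have ZE : Z = 2 / (r * sphere_area R m.+2 * r ^+ m) * (s2 + lam m.+2 m.+2%:R).
  rewrite /Z /r Zform//= subrr g00 -/r -[X in powR X _]r2 powR_half_sub1//.
  by rewrite -[in r ^+ m.+2]addn2 exprD mulfK// expf_neq0// gt_eqF.
have lamD : D <= s2 + lam m.+2 m.+2%:R.
  rewrite lerD2l lerNl; apply: (@le_trans _ _ `|- lam m.+2 m.+2%:R|).
    exact: ler_norm.
  by rewrite normrN lamL.
have Z0 : 0 < Z.
  rewrite ZE; apply: mulr_gt0; last exact: lt_le_trans lamD.
  apply: divr_gt0; first exact: ltr0n.
  exact: (mulr_gt0 (mulr_gt0 r0 aN0) rm0).
pose A := Num.sqrt 3 * (B / D).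
(* The area of the unit sphere in dimension N and the power of [r] occur in both [Z] and the slicing
   bound and cancel, leaving sqrt(N / (N-2)) times the ratio of the concentration factors. *)
have coef : b / (sphere_area R m.+2 * r ^+ m) / Z <= A.
  have -> : b / (sphere_area R m.+2 * r ^+ m) / Z =
      r / Num.sqrt m%:R * (B / (s2 + lam m.+2 m.+2%:R)).
    have sl0 := lt_le_trans D0 lamD.
    rewrite ZE /b; field.
    by rewrite (gt_eqF sl0) (gt_eqF rm0) (gt_eqF sm0) (gt_eqF aN0) (gt_eqF r0).
  apply: ler_pM; rewrite ?divr_ge0 ?(ltW B0) ?(ltW (lt_le_trans D0 lamD))//.
    exact: ltW.
  - exact: sqrt_quotient_le3.
  - by rewrite ler_pM2l// lef_pV2// posrE// (lt_le_trans D0).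
have A0 : 0 <= A by rewrite mulr_ge0// divr_ge0// ltW.
have K0' := ltW K0.
pose I theta := (\int[lebesgue_measure]_x \int[lebesgue_measure]_y
     (weight f Phi beta K (cos theta) (sin theta) x y)%:E +
   \int[lebesgue_measure]_x \int[lebesgue_measure]_y
     (weight_rot f Phi beta K (cos theta) (sin theta) x y)%:E)%E.
have I0 theta : (0 <= I theta)%E.
  by apply: adde_ge0; apply: integral_ge0 => x _; apply: integral_ge0 => y _;
    rewrite lee_fin; [exact: weight_ge0|exact: weight_rot_ge0].
have bound theta :
  (sphere_int m.+2 r (fun v => (psi beta (condtens f m.+2 v)
       (condtens f m.+2 (rot12 theta v)))%:E)
   <= (A * powR 2 (2 * beta))%:E * I theta)%E.
  have Phi0' v : 0 <= Phi v by exact: ltW.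
  apply: (le_trans (sphere_int_psi_le mf fpos mPhi Phi0' lnf lnPhi (ltW Cf0) beta0 b0 r0 Z0 Zb theta)).
  apply: lee_wpmul2r; first exact: I0.
  by rewrite lee_fin ler_wpM2r ?powR_ge0.
rewrite /log_power_functional -/m -/r.
have pi0 : 0 < pi :> R by exact: pi_gt0.
have k0 : 0 <= A * powR 2 (2 * beta) by rewrite mulr_ge0// powR_ge0.
apply: (@le_trans _ _ (((2 * pi)^-1)%:E * ((A * powR 2 (2 * beta))%:E *
  (2%:E * ((4 * pi * K)%:E + 2%:E * MA%:E)))))%E.
  apply: lee_wpmul2l; first by rewrite lee_fin invr_ge0 mulr_ge0// ltW.
  rewrite -MAE -(integral_weights beta mf f0 f1 mPhi K0') -ge0_integralZl//.
  - apply: le_integral_ge0 => theta _; last exact: bound.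
    by apply: sphere_int_ge0 => v; rewrite lee_fin mulr_ge0// powR_ge0.
  - apply: measurable_funTS.
    exact: (measurable_integral_weights beta mf f0 mPhi K0').
  - by move=> theta _; exact: I0.
rewrite -[(2%:E * MA%:E)%E]EFinM -[((4 * pi * K)%:E + _)%E]EFinD -!EFinM lee_fin /base.
have -> : powR 2 (1 + 2 * beta) = 2 * powR 2 (2 * beta) :> R.
  by rewrite powRD ?pnatr_eq0 ?implybT// powRr1.
set q := powR 2 _.
(* Each of the two weights has angular mean 2 K + MA / pi; their number is the factor 2 that
   completes [powR 2 (1 + 2 * beta)]. *)
have simpl_pi (P : R) : P != 0 ->
    (2 * P)^-1 * (A * q * (2 * (4 * P * K + 2 * MA))) = 2 * q * A * (2 * K + MA / P).
  by move=> P0; field.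
rewrite simpl_pi ?gt_eqF//.
have -> : 2 * q * Num.sqrt 3 * (B / D) = 2 * q * A by rewrite /A; ring.
have q0 : 0 <= q by exact: powR_ge0.
apply: ler_wpM2l; first by rewrite mulr_ge0 ?A0 ?mulr_ge0 ?q0 ?ler0n.
rewrite -addrA lerD2l.
apply: (@le_trans _ _ MA); last by rewrite lerDr.
rewrite ler_pdivrMr// ler_peMr//.
by apply: le_trans (pi_ge2 R); rewrite ler1n.
Qed.
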